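(* Let $\Pi=(\Sigma_{in},\Sigma_{out},\mathcal{P})$ be an LCL in normal form, $\sigma\in\Sigma_{in}$, $(\Upsilon,\nabla)$ a subpartition of $\Sigma_{out}$ with $\Upsilon=(\mathbb{P},\preceq)$, such that $\Pi$ is $(\sigma,\Upsilon,\nabla)$-mixing, and let $B_1,\dots,B_\ell$ be permutation $\sigma$-blocks on $(\Upsilon,\nabla)$ whose permutations $\pi_{B_1},\dots,\pi_{B_\ell}$ generate $\Gamma_{\sigma,(\Upsilon,\nabla)}$. Let $\mathcal{K}$, $\tau$, $\nu$ be as in the context, and let $f:\mathcal{K}\to\Sigma_{out}^{\mathbb{Z}}$ be a Borel map that is equivariant for the shift action. Let $\mathcal{C}$, $\mathcal{L}$, $\mathcal{S}=\mathcal{C}\setminus\mathcal{L}$ and $\Lambda_f$ be as in the context. (Measure case) If $\nu(\mathcal{C})=1$, then there is a $\nu$-conull set $D\subseteq\mathcal{S}$ such that: (1) whenever $y,y'\in D$ agree on all coordinates indexed by $\{0,1,2,\dots\}$ (in all three components), then $\Lambda_f(y)(0)=\Lambda_f(y')(0)$; and (2) whenever $y,y'\in D$ agree on all coordinates indexed by $\{\dots,-2,-1\}$, then $\Lambda_f(y)(0)=\Lambda_f(y')(0)$. (Baire case) If $\mathcal{C}$ is $\tau$-comeager, then the same holds with a $\tau$-comeager set $D\subseteq\mathcal{S}$ in place of a $\nu$-conull one.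
   Context: Normal form LCL: $\Pi=(\Sigma_{in},\Sigma_{out},\mathcal{P})$, $\Sigma_{in},\Sigma_{out}$ finite, $\mathcal{P}:\Sigma_{in}^2\times\Sigma_{out}^2\to\{\texttt{true},\texttt{false}\}$; a pair $(\mathcal{I},g)\in\Sigma_{in}^{\mathbb{Z}}\times\Sigma_{out}^{\mathbb{Z}}$ is a $\Pi$-coloring if $\mathcal{P}((\mathcal{I}(n),\mathcal{I}(n+1)),(g(n),g(n+1)))=\texttt{true}$ for all $n\in\mathbb{Z}$. A $\sigma$-block is a sequence $B=(\beta_0,\dots,\beta_m)$ in $\Sigma_{in}$, $m\ge1$, $\beta_0=\beta_m=\sigma$; $\texttt{type}(B)$ is the set of $(\mathtt{a},\mathtt{b})\in\Sigma_{out}^2$ such that some $c_0=\mathtt{a},\dots,c_m=\mathtt{b}$ has $\mathcal{P}((\beta_j,\beta_{j+1}),(c_j,c_{j+1}))=\texttt{true}$ for all $j<m$. A subpartition $(\Upsilon,\nabla)$: $\nabla$ is an equivalence relation on a subset $\operatorname{dom}(\nabla)\subseteq\Sigma_{out}$, $\Upsilon=(\mathbb{P},\preceq)$ with $\mathbb{P}$ an equivalence relation on $\Sigma_{out}$ coarser than $\nabla$ on $\operatorname{dom}(\nabla)$ and $\preceq$ a partial order on $\mathbb{P}$-classes. $B$ is a permutation block on $(\Upsilon,\nabla)$ if there is a permutation $\pi_B$ of the $\nabla$-classes with: (1) $\pi_B([\mathtt{a}]_\nabla)=[\mathtt{b}]_\nabla\Rightarrow\mathbb{P}(\mathtt{a})=\mathbb{P}(\mathtt{b})$;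 (2) $(\mathtt{a},\mathtt{b})\in\texttt{type}(B)\Rightarrow\mathbb{P}(\mathtt{a})\preceq\mathbb{P}(\mathtt{b})$; (3) $\mathtt{a}\notin\operatorname{dom}(\nabla)$, $(\mathtt{a},\mathtt{b})\in\texttt{type}(B)\Rightarrow\mathbb{P}(\mathtt{a})\neq\mathbb{P}(\mathtt{b})$; (4) $\mathtt{a},\mathtt{b}\in\operatorname{dom}(\nabla)$, $(\mathtt{a},\mathtt{b})\in\texttt{type}(B)$, $\mathbb{P}(\mathtt{a})=\mathbb{P}(\mathtt{b})\Rightarrow\pi_B([\mathtt{a}]_\nabla)=[\mathtt{b}]_\nabla$. $\Gamma_{\sigma,(\Upsilon,\nabla)}$ is the group of all such $\pi_B$ over permutation $\sigma$-blocks $B$ on $(\Upsilon,\nabla)$, acting on $\nabla$-classes; $\Pi$ is $(\sigma,\Upsilon,\nabla)$-mixing if this action has no fixed point. The space $\mathcal{K}$: the set of $(\mathcal{I},x,b)\in\Sigma_{in}^{\mathbb{Z}}\times(2^{\mathbb{N}})^{\mathbb{Z}}\times([\ell]\times\{0,1\})^{\mathbb{Z}}$ such that $\mathcal{I}$ is a bi-infinite concatenation of blocks from $\{B_1,\dots,B_\ell\}$ (consecutive blocks share the endpoint labeled $\sigma$), $b(n)=(k,1)$ if $n$ is the starting point of a block which is a copy of $B_k$, $b(n)=(k,0)$ if $n$ is a non-starting point of a copy of $B_k$ (the last point of a block counts as the start of the next block), and such that $n\cdot(\mathcal{I},x,b)\neq(\mathcal{I},x,b)$ for all $n\neq0$,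 where $(n\cdot y)(k)=y(n+k)$ is the shift. $\tau$ is the subspace topology from the product topology ($\Sigma_{in}$, $[\ell]\times\{0,1\}$ discrete, $2^{\mathbb{N}}$ Cantor). The measure $\nu=\lambda\times\mu$: $\lambda$ is the product of uniform measures on $(2^{\mathbb{N}})^{\mathbb{Z}}$; writing $B_i=(\beta^i_0,\dots,\beta^i_{m_i})$, $\mu$ is the law of the stationary bi-infinite Markov chain with states $(\beta^i_j,j,i)$, $i\in[\ell]$, $0\le j<m_i$, uniform stationary distribution, transitions $(\beta^i_j,j,i)\to(\beta^i_{j+1},j+1,i)$ with probability $1$ for $j<m_i-1$ and $(\beta^i_{m_i-1},m_i-1,i)\to(\beta^{i'}_0,0,i')$ with probability $1/\ell$ for each $i'\in[\ell]$; a state $(\beta,j,i)$ at time $n$ gives $\mathcal{I}(n)=\beta$ and $b(n)=(i,1)$ if $j=0$, $(i,0)$ otherwise. Then $\nu(\mathcal{K})=1$ and $\nu$ is shift-invariant. Given $f$: $\mathcal{C}$ is the set of $y=(\mathcal{I},x,b)\in\mathcal{K}$ with $(\mathcal{I},f(y))$ a $\Pi$-coloring; $\mathcal{L}$ is the set of $y$ for which there are $i,j$ with $b(i),b(j)\in[\ell]\times\{1\}$ and $\mathbb{P}(f(y)(i))\neq\mathbb{P}(f(y)(j))$; $\mathcal{S}=\mathcal{C}\setminus\mathcal{L}$. For $y\in\mathcal{S}$ and $j\in\mathbb{Z}$ let $i\le j$ be the largest index with $b(i)\in[\ell]\times\{1\}$ and set $\Lambda_f(y)(j)=[f(y)(i)]_\nabla$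 (on $\mathcal{S}$, $f(y)(i)\in\operatorname{dom}(\nabla)$ at block starts, so this is well-defined). *)

(* Defs.v *)
From HB Require Import structures.
From mathcomp Require Import all_boot all_order all_algebra all_fingroup.
From mathcomp Require Import all_classical all_reals all_analysis.
From mathcomp Require Import borel_hierarchy.

Set Implicit Arguments.
Unset Strict Implicit.
Unset Printing Implicit Defensive.

Import Order.TTheory GRing.Theory Num.Theory.

Local Open Scope classical_set_scope.
Local Open Scope ring_scope.

Record lcl := Lcl {
  Sin : finType;
  Sout : finType;
  allowed : Sin * Sin -> Sout * Sout -> bool }.

Definition coloring (Pi : lcl) (I : int -> Sin Pi) (g : int -> Sout Pi) : Prop :=
  forall n : int, allowed (I n, I (n + 1)) (g n, g (n + 1)).

(* The sequence (beta_0, ..., beta_m) with m >= 1 and both ends equal to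
   sigma; the length [blen] is m, one less than the number of letters. *)
Record block (A : finType) (sigma : A) := Block {
  letters : seq A;
  blockP : [&& (1 < size letters)%N, head sigma letters == sigma
             & last sigma letters == sigma] }.

Definition blen (A : finType) (sigma : A) (B : block sigma) : nat :=
  (size (letters B)).-1.

Definition beta (A : finType) (sigma : A) (B : block sigma) (j : nat) : A :=
  nth sigma (letters B) j.

Lemma blen_gt0 (A : finType) (sigma : A) (B : block sigma) : (0 < blen B)%N.
Proof. by case: B => -[|a [|b s]]. Qed.

Definition block_type (Pi : lcl) (sigma : Sin Pi) (B : block sigma) :
    set (Sout Pi * Sout Pi) :=
  [set ab | exists c : nat -> Sout Pi,
     [/\ c 0%N = ab.1, c (blen B) = ab.2 &
      forall j, (j < blen B)%N ->
        allowed (beta B j, beta B j.+1) (c j, c j.+1)]].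

(* [nabla] only matters on its domain [sdom], and [prec] only on the classes
   of [PP]. *)
Record subpartition (O : finType) := Subpartition {
  sdom : {set O};
  nabla : rel O;
  PP : rel O;
  prec : rel {set O};
  nabla_equiv : {in sdom & &, equivalence_rel nabla};
  PP_equiv : equivalence_rel PP;
  PP_coarser : {in sdom &, forall a b, nabla a b -> PP a b};
  prec_refl : {in equivalence_partition PP [set: O]%SET, reflexive prec};
  prec_anti : {in equivalence_partition PP [set: O]%SET &, antisymmetric prec};
  prec_trans : {in equivalence_partition PP [set: O]%SET & &, transitive prec} }.

Section SubpartitionClasses.
Variables (O : finType) (U : subpartition O).

Definition Pclass (a : O) : {set O} := [set b | PP U a b]%SET.

Definition nablaset (a : O) : {set O} := [set b in sdom U | nabla U a b]%SET.

Definition nclass : finType :=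
  {C : {set O} | C \in equivalence_partition (nabla U) (sdom U)}.

Definition nclass_of (a : O) (aD : a \in sdom U) : nclass :=
  exist _ (nablaset a) (imset_f _ aD).

End SubpartitionClasses.

(* B is a permutation block on U, witnessed by p. *)
Record permutation_block (Pi : lcl) (sigma : Sin Pi)
    (U : subpartition (Sout Pi)) (B : block sigma) (p : {perm nclass U}) :
    Prop := PermutationBlock {
  pb_perm : forall a b (aD : a \in sdom U) (bD : b \in sdom U),
    p (nclass_of aD) = nclass_of bD -> Pclass U a = Pclass U b;
  pb_prec : forall a b, block_type B (a, b) -> prec U (Pclass U a) (Pclass U b);
  pb_notin : forall a b, a \notin sdom U -> block_type B (a, b) ->
    Pclass U a <> Pclass U b;
  pb_in : forall a b (aD : a \in sdom U) (bD : b \in sdom U),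
    block_type B (a, b) -> Pclass U a = Pclass U b ->
    p (nclass_of aD) = nclass_of bD }.

(* A set of permutations; by [Gamma_group] it is a group as soon as there is
   at least one permutation block. *)
Definition Gamma (Pi : lcl) (sigma : Sin Pi) (U : subpartition (Sout Pi)) :
    {set {perm nclass U}} :=
  [set p | `[< exists B : block sigma, permutation_block B p >]]%SET.

(* Concatenation of blocks, the shared letter sigma being written once. *)
Lemma block_catP (A : finType) (sigma : A) (B B' : block sigma) :
  [&& (1 < size (letters B ++ behead (letters B')))%N,
      head sigma (letters B ++ behead (letters B')) == sigma
    & last sigma (letters B ++ behead (letters B')) == sigma].
Proof.
case: B B' => -[|a [|b s]] //= /andP[-> ls] [[|a' [|b' s']]] //= /andP[_ ls'].
by rewrite last_cat.
Qed.

Definition block_cat (A : finType) (sigma : A) (B B' : block sigma) :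
  block sigma := Block (block_catP B B').

Lemma block_type_cat (Pi : lcl) (sigma : Sin Pi) (B B' : block sigma) a b :
  block_type (block_cat B B') (a, b) ->
  exists2 c, block_type B (a, c) & block_type B' (c, b).
Proof.
case=> c [/= c0 cm H].
have Em : blen (block_cat B B') = (blen B + blen B')%N.
  rewrite /blen /= size_cat size_behead.
  by case: B {c0 cm H} => -[|? ?].
have bl j : (j < blen B)%N -> beta (block_cat B B') j = beta B j.
  move=> jB; rewrite /beta nth_cat /=; case: ltnP => //.
  by rewrite leqNgt (leq_trans jB) // leq_pred.
have br j : (j <= blen B')%N ->
    beta (block_cat B B') (blen B + j) = beta B' j.
  rewrite /beta nth_cat /= /blen.
  case: B {c0 cm H Em bl} => -[|a0 s] //= /and3P[s0 _ /eqP ls].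
  case: B' => -[|a0' s'] //= /and3P[_ /eqP h' _].
  case: j => [|j] jB'.
    by rewrite addn0 ltnSn h' -ls nth_last.
  by rewrite ltnNge addnS ltnS leq_addr /= subSS addKn.
have bB : beta B (blen B) = beta B' 0.
  rewrite /beta /blen.
  case: B {c0 cm H Em bl br} => -[|a0 s] //= /and3P[s0 _ /eqP ls].
  case: B' => -[|a0' s'] //= /and3P[_ /eqP h' _].
  by rewrite h' -ls nth_last.
exists (c (blen B)).
  exists c; split=> // j jB.
  have := H j; rewrite Em bl // => /(_ (ltn_addr _ jB)).
  move: jB; rewrite leq_eqVlt => /predU1P[jB|jB]; last by rewrite bl.
  by rewrite jB -{1}[blen B]addn0 br // bB.
exists (fun j => c (blen B + j)%N); rewrite addn0 -Em; split=> // j jB.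
by have := H (blen B + j)%N; rewrite Em ltn_add2l -addnS !br ?(ltnW jB) // => /(_ jB).
Qed.

Lemma GammaM (Pi : lcl) (sigma : Sin Pi) (U : subpartition (Sout Pi)) p q :
  p \in Gamma sigma U -> q \in Gamma sigma U -> (p * q)%g \in Gamma sigma U.
Proof.
rewrite !finset.inE => /asboolP[B HB] /asboolP[B' HB']; apply/asboolP.
have cl z : Pclass U z \in equivalence_partition (PP U) [set: Sout Pi]%SET.
  by apply/imsetP; exists z; rewrite ?finset.inE //; apply/setP => w; rewrite !finset.inE.
have Pcls (x y : Sout Pi) : prec U (Pclass U x) (Pclass U y) ->
    prec U (Pclass U y) (Pclass U x) -> Pclass U x = Pclass U y.
  by move=> h1 h2; apply: (prec_anti (cl x) (cl y)); rewrite h1.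
exists (block_cat B B'); split.
- move=> a b aD bD; rewrite permM.
  have [c [cD pE]] : exists c (cD : c \in sdom U), p (nclass_of aD) = nclass_of cD.
    by case/imsetP: (valP (p (nclass_of aD))) => c cD E; exists c, cD; apply/val_inj.
  by rewrite pE => /(pb_perm HB') <-; exact: (pb_perm HB pE).
- move=> a b /block_type_cat[c /(pb_prec HB) ac /(pb_prec HB') cb].
  exact: (prec_trans (cl c) (cl a) (cl b) ac cb).
- move=> a b aD /block_type_cat[c ac cb] ab.
  apply: (pb_notin HB aD ac); apply: Pcls; first exact: (pb_prec HB ac).
  by rewrite ab; exact: (pb_prec HB' cb).
- move=> a b aD bD /block_type_cat[c ac cb] ab.
  have E : Pclass U a = Pclass U c.
    by apply: Pcls (pb_prec HB ac) _; rewrite ab; exact: (pb_prec HB' cb).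
  have [cD|cD] := boolP (c \in sdom U).
    by rewrite permM (pb_in HB aD cD ac E) (pb_in HB' cD bD cb) // -E.
  by case: (pb_notin HB' cD cb); rewrite -E.
Qed.

Lemma Gamma_group (Pi : lcl) (sigma : Sin Pi) (U : subpartition (Sout Pi)) p :
  p \in Gamma sigma U -> group_set (Gamma sigma U).
Proof.
move=> pG; apply/group_setP; split; last exact: GammaM.
rewrite -(expg_order p); case: #[p]%g (order_gt0 p) => // n _.
by elim: n => [|n IH]; rewrite ?expg1 // expgS GammaM.
Qed.

Definition mixing (Pi : lcl) (sigma : Sin Pi) (U : subpartition (Sout Pi)) :
    Prop :=
  forall C : nclass U, exists2 p, p \in Gamma sigma U & p C <> C.

(* T with the discrete topology and base point x; a base point is needed to
   speak of measures, its choice is irrelevant. *)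
Definition pdiscrete (T : choiceType) (x : T) : Type := discrete_topology T.
HB.instance Definition _ (T : choiceType) (x : T) :=
  Topological.copy (pdiscrete x) (discrete_topology T).
HB.instance Definition _ (T : choiceType) (x : T) :=
  isPointed.Build (pdiscrete x) x.

Definition bilateral (T : Type) : Type := prod_topology (fun _ : int => T).
HB.instance Definition _ (T : topologicalType) :=
  Topological.copy (bilateral T) (prod_topology (fun _ : int => T)).
HB.instance Definition _ (T : pointedType) :=
  isPointed.Build (bilateral T) (fun=> point).
HB.instance Definition _ (T : ptopologicalType) := Topological.on (bilateral T).

HB.instance Definition _ (T T' : ptopologicalType) := Topological.on (T * T')%type.

Definition borel (T : ptopologicalType) := g_sigma_algebraType (@open T).

Definition config (A : finType) (sigma : A) (l : nat) : ptopologicalType :=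
  [the ptopologicalType of
   (bilateral (pdiscrete sigma) * bilateral cantor_space *
    bilateral (pdiscrete (ord0 : 'I_l.+1, true)))%type].

Definition shift (T : Type) (n : int) (u : int -> T) : int -> T :=
  fun k => u (n + k).

Section SpaceK.
Variables (A : finType) (sigma : A) (l : nat) (B : 'I_l.+1 -> block sigma).

Definition inp (y : config sigma l) : int -> A := y.1.1.
Definition rnd (y : config sigma l) : int -> cantor_space := y.1.2.
Definition lab (y : config sigma l) : int -> 'I_l.+1 * bool := y.2.

Definition shift_config (n : int) (y : config sigma l) : config sigma l :=
  (shift n (inp y), shift n (rnd y), shift n (lab y)).

(* The t-th block starts at position s t and is a copy of B (k t). *)
Definition concatenation (y : config sigma l) : Prop :=
  exists (s : int -> int) (k : int -> 'I_l.+1), forall t : int,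
    [/\ s (t + 1) = s t + (blen (B (k t)))%:Z,
        (forall j : nat, (j <= blen (B (k t)))%N ->
           inp y (s t + j%:Z) = beta (B (k t)) j) &
        (forall j : nat, (j < blen (B (k t)))%N ->
           lab y (s t + j%:Z) = (k t, j == 0%N))].

Definition Kset : set (config sigma l) :=
  [set y | concatenation y /\ forall n : int, n != 0 -> shift_config n y <> y].

Lemma shift_configD m n y :
  shift_config m (shift_config n y) = shift_config (n + m) y.
Proof.
by congr (_, _, _); apply/funext => k; rewrite /inp /rnd /lab /= /shift addrA.
Qed.

Lemma shift_config0 y : shift_config 0 y = y.
Proof.
case: y => -[I x] b.
by congr (_, _, _); apply/funext => k; rewrite /shift /= add0r.
Qed.

Lemma Kset_shift (n : int) (y : config sigma l) :
  Kset y -> Kset (shift_config n y).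
Proof.
move=> [[s [k Hsk]] Hper]; split; last first.
  move=> m m0 /(congr1 (shift_config (- n))).
  rewrite !shift_configD addrN shift_config0 subrKC.
  exact: Hper.
exists (fun t => s t - n), k => t; have [H1 H2 H3] := Hsk t.
have E a : n + (s t - n + a) = s t + a by rewrite addrA (addrC n) subrK.
split; first by rewrite H1 addrAC.
- by move=> j /H2; rewrite {2}/inp /= /shift E.
- by move=> j /H3; rewrite {2}/lab /= /shift E.
Qed.

(* The coercion of [Kset] to a type carries the subspace topology. *)
Definition shiftK (n : int) (y : Kset) : Kset :=
  exist _ (shift_config n (set_val y))
    (mem_set (Kset_shift n (set_mem (valP y)))).

End SpaceK.

Definition comeager (T : topologicalType) (D : set T) : Prop :=
  exists2 G : set T, Gdelta_dense G & G `<=` D.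

Section Measure.
Variable R : realType.

(* The fair-coin measure on the Cantor space. *)
Definition uniform_cantor (u : probability (borel cantor_space) R) : Prop :=
  forall (n : nat) (c : cantor_space),
    u [set x : cantor_space | forall k, (k < n)%N -> x k = c k]
    = ((2^-1) ^+ n)%:E.

Definition is_product (T : ptopologicalType) (u : probability (borel T) R)
    (m : probability (borel (bilateral T)) R) : Prop :=
  forall (s : seq int) (E : int -> set (borel T)),
    uniq s -> (forall n, measurable (E n)) ->
    m [set x : bilateral T | forall n, n \in s -> E n (x n)]
    = (\prod_(n <- s) u (E n))%E.

(* The finite-dimensional distributions, started at an arbitrary time n, of
   the stationary two-sided Markov chain with stationary distribution q and
   transition probabilities tr; they determine m. *)
Definition is_markov (S : choiceType) (s0 : S) (q : S -> R) (tr : S -> S -> R)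
    (m : probability (borel (bilateral (pdiscrete s0))) R) : Prop :=
  forall (n : int) (r : nat) (w : nat -> S),
    m [set z : bilateral (pdiscrete s0) |
       forall j, (j <= r)%N -> z (n + j%:Z) = w j]
    = (q (w 0%N) * \prod_(j < r) tr (w j) (w j.+1))%:E.

Variables (A : finType) (sigma : A) (l : nat) (B : 'I_l.+1 -> block sigma).

(* The pair (i, j) stands for the state (beta^i_j, j, i). *)
Definition state : finType := {i : 'I_l.+1 & 'I_(blen (B i))}.

Definition state0 : state := existT _ ord0 (Ordinal (blen_gt0 (B ord0))).

Definition chain_init (s : state) : R := (#|{: state}|%:R)^-1.

Definition chain_trans (s t : state) : R :=
  if ((tagged s).+1 < blen (B (tag s)))%N then
    ((tag t == tag s) && (tagged t == (tagged s).+1 :> nat))%:R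
  else (tagged t == 0%N :> nat)%:R / l.+1%:R.

Definition chain_law
    (m : probability (borel (bilateral (pdiscrete state0))) R) : Prop :=
  is_markov chain_init chain_trans m.

Definition IBspace : ptopologicalType :=
  [the ptopologicalType of
   (bilateral (pdiscrete sigma) *
    bilateral (pdiscrete (ord0 : 'I_l.+1, true)))%type].

Definition readout (z : borel (bilateral (pdiscrete state0))) : borel IBspace :=
  ((fun n => beta (B (tag (z n))) (tagged (z n))) : bilateral (pdiscrete sigma),
   (fun n => (tag (z n), tagged (z n) == 0%N :> nat))
     : bilateral (pdiscrete (ord0 : 'I_l.+1, true))).

Definition reorder (p : borel (bilateral cantor_space) * borel IBspace) :
    borel (config sigma l) :=
  (p.2.1, p.1, p.2.2).

Definition mu (m : probability (borel (bilateral (pdiscrete state0))) R) :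
    set (borel IBspace) -> \bar R :=
  pushforward m readout.

(* The product measure lambda x mu, transported from pairs (x, (I, b)) to
   triples (I, x, b). *)
Definition nu (lambda : probability (borel (bilateral cantor_space)) R)
    (m : probability (borel (bilateral (pdiscrete state0))) R) :
    set (borel (config sigma l)) -> \bar R :=
  pushforward (lambda \x mu m)%E reorder.

End Measure.

Section Maps.
Variables (Pi : lcl) (sigma : Sin Pi) (U : subpartition (Sout Pi)).
Variables (l : nat) (B : 'I_l.+1 -> block sigma).
Variable f : Kset B -> bilateral (discrete_topology (Sout Pi)).

Definition borel_map : Prop :=
  forall V : set (bilateral (discrete_topology (Sout Pi))),
    open V -> <<s (@open (Kset B)) >> (f @^-1` V).

Definition equivariant : Prop :=
  forall (n : int) (y : Kset B), f (shiftK n y) = shift n (f y).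

Definition Cset : set (Kset B) :=
  [set y | coloring (inp (set_val y)) (f y)].

Definition Lset : set (Kset B) :=
  [set y | exists i j : int,
    [/\ (lab (set_val y) i).2, (lab (set_val y) j).2 &
        Pclass U (f y i) <> Pclass U (f y j)]].

Definition Sset : set (Kset B) := Cset `\` Lset.

(* The largest i <= j at which a block starts. On K it always exists; the
   default value j of [xget] is never used there. *)
Definition last_start (y : Kset B) (j : int) : int :=
  xget j [set i : int | [/\ i <= j, (lab (set_val y) i).2 &
    forall k : int, i < k <= j -> (lab (set_val y) k).2 = false]].

Definition Lambda (y : Kset B) (j : int) : {set Sout Pi} :=
  nablaset U (f y (last_start y j)).

Definition agree_on (J : set int) (y y' : Kset B) : Prop :=
  forall n, J n -> [/\ inp (set_val y) n = inp (set_val y') n,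
                       rnd (set_val y) n = rnd (set_val y') n &
                       lab (set_val y) n = lab (set_val y') n].

Definition Lambda0_determined (D : set (Kset B)) (J : set int) : Prop :=
  forall y y' : Kset B, D y -> D y' -> agree_on J y y' ->
    Lambda y 0 = Lambda y' 0.

End Maps.

(* Main.v *)
Require Import Defs.
From HB Require Import structures.
From mathcomp Require Import all_boot all_order all_algebra all_fingroup.
From mathcomp Require Import all_classical all_reals all_analysis.
From mathcomp Require Import borel_hierarchy.
From mathcomp Require Import zify.

Set Implicit Arguments.
Unset Strict Implicit.
Unset Printing Implicit Defensive.

Import Order.TTheory GRing.Theory Num.Theory.

Local Open Scope classical_set_scope.
Local Open Scope ring_scope.

(** Write q(n) for the output letter at the last block start at or before n. On
    colorings the P-class of q(n) is nondecreasing in n, and if it is constant then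
    the nabla-classes of q(n) and q(n + 1) determine each other through a permutation
    read off the blocks. So two configurations with a common future (or past) have
    the same class at 0 as soon as they have the same class at one common time there.

    Measure: the law of the P-class of q(n) does not depend on n, so this
    nondecreasing sequence is almost surely constant. The event q(0) = a is approximated within 2^-k by
    an event seen in a finite window; by Borel-Cantelli, along times n_k far enough in
    the future (or past) q(n_k) is eventually read off the future (or past) alone.

    Category: some letter a is generically the value of q(0) on a nonempty open set.
    Since any two finite patterns can be glued into one aperiodic concatenation, a
    generic configuration visits this set at arbitrarily large positive and negative
    times; by monotonicity the P-class is constant, and two configurations with a
    common future visit it simultaneously. *)

(** * Topologies and Borel sets generated by countably many coordinates *)

Definition finitely_determined (T : Type) (J : eqType) (c : J -> T -> nat) (F : set T) : Prop :=
  exists s : seq J, forall y y', {in s, forall j, c j y = c j y'} -> F y <-> F y'.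

Section Coordinates.
Variables (T : topologicalType) (J : countType) (c : J -> T -> nat).

(* Coordinates are coded in nat so that there are countably many cylinders. *)
Definition coordinates : Prop :=
  (forall j v, open [set y | c j y = v]) /\
  (forall (y : T) (V : set T), nbhs y V ->
     exists s : seq J, forall z, {in s, forall j, c j z = c j y} -> V z).

Definition cylinder (d : seq (J * nat)) : set T :=
  [set z | forall jv, jv \in d -> c jv.1 z = jv.2].

Lemma cylinder_cat d d' : cylinder (d ++ d') = cylinder d `&` cylinder d'.
Proof.
apply/seteqP; split=> z /=.
  by move=> H; split=> jv jvd; apply: H; rewrite mem_cat jvd ?orbT.
by case=> H H' jv; rewrite mem_cat => /orP[/H|/H'].
Qed.

Hypothesis cT : coordinates.

Lemma cylinder_open d : open (cylinder d).
Proof.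
elim: d => [|[j v] d IHd].
  by rewrite (_ : cylinder [::] = setT); [exact: openT|apply/seteqP; split].
rewrite (_ : cylinder _ = [set y | c j y = v] `&` cylinder d).
  by apply: openI IHd; exact: cT.1.
apply/seteqP; split=> z /=.
  by move=> H; split=> [|jv jvd]; [apply: (H (j, v))|apply: H]; rewrite inE ?eqxx ?jvd ?orbT.
by case=> H H' jv; rewrite inE => /predU1P[->|/H'].
Qed.

(** There are countably many cylinders and they form a base. The union runs over codes in [nat], the
    inner one having at most one member, so that closure under unions indexed by [nat] applies. *)
Lemma open_cylinders (V : set T) : open V ->
  V = \bigcup_(n in [set n | exists2 d, unpickle n = Some d & cylinder d `<=` V])
    \bigcup_(d in [set d | unpickle n = Some d]) cylinder d.
Proof.
move=> oV; apply/seteqP; split=> z /=; last first.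
  move=> [n [d nd dV] [d' /= nd' d'z]]; apply: dV.
  by move: nd' d'z; rewrite nd => -[->].
move=> Vz; have [s Hs] := cT.2 _ _ (open_nbhs_nbhs (conj oV Vz)).
pose d := [seq (j, c j z) | j <- s].
exists (pickle d).
  exists d; rewrite ?pickleK // => w /= Hw; apply: Hs => j js.
  by apply: (Hw (j, c j z)); apply: map_f.
by exists d; rewrite /= ?pickleK // => _ /mapP[j _ ->].
Qed.

Lemma open_sigma_cylinder (V : set T) : open V -> <<s range cylinder >> V.
Proof.
move=> oV; rewrite (open_cylinders oV).
rewrite bigcup_mkcond; apply: sigma_algebra_bigcup => n.
have S0 : <<s range cylinder >> set0 by case: (smallest_sigma_algebra setT (range cylinder)).
case: ifP => // _; case E : (unpickle n) => [d|]; last first.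
  by rewrite (_ : [set d | _] = set0) ?bigcup_set0 //; apply/seteqP; split=> // d /=.
rewrite (_ : [set d | _] = [set d]) ?bigcup_set1; last first.
  by apply/seteqP; split=> d' /= [->].
by apply: sub_sigma_algebra; exists d.
Qed.

Lemma sigma_open_cylinder : <<s @open T >> = <<s range cylinder >>.
Proof.
apply/seteqP; split.
  by apply: smallest_sub; [exact: smallest_sigma_algebra|exact: open_sigma_cylinder].
apply: smallest_sub; first exact: smallest_sigma_algebra.
by move=> _ [d _ <-]; apply: sub_sigma_algebra; apply: cylinder_open.
Qed.

End Coordinates.

Section BorelCoordinates.
Variables (T : ptopologicalType) (J : countType) (c : J -> T -> nat).
Hypothesis cT : coordinates c.

Lemma measurable_to_borel d (S : measurableType d) (g : S -> borel T) :
  (forall j v, measurable [set y | c j (g y) = v]) -> measurable_fun setT g.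
Proof.
move=> H; apply: (@measurability _ _ S (borel T) setT g (range (cylinder c))).
  by rewrite /measurable /= -(sigma_open_cylinder cT).
move=> _ [_ [D _ <-] <-]; rewrite setTI.
rewrite (_ : _ @^-1` _ = \bigcap_(jv in [set` D]) [set y | c jv.1 (g y) = jv.2]) //.
by apply: fin_bigcap_measurable => [|jv _]; [exact: finite_seq|exact: H].
Qed.

(** Cylinders generate the Borel sets and form a pi-system: an intersection of two is the cylinder
    of the concatenated lists. *)
Lemma borel_prob_eq (R : realType) (m1 m2 : {measure set (borel T) -> \bar R}) :
  (m1 setT < +oo)%E -> (forall d, m1 (cylinder c d) = m2 (cylinder c d)) ->
  forall A : set (borel T), measurable A -> m1 A = m2 A.
Proof.
move=> m1T H A mA; apply: (@measure_unique _ R (borel T) (range (cylinder c)) (fun=> setT)) => //.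
- by rewrite -(sigma_open_cylinder cT).
- by move=> _ _ [d _ <-] [d' _ <-]; exists (d ++ d') => //; rewrite cylinder_cat.
- by move=> _; exists [::] => //; apply/seteqP; split.
- by rewrite bigcup_const //; exists 0%N.
- by move=> _ [d _ <-].
Qed.

End BorelCoordinates.

Lemma coordinates_discrete (T : discreteTopologicalType) (e : T -> nat) :
  injective e -> coordinates (fun (_ : unit) => e).
Proof.
move=> ei; split=> [_ v|y V yV]; first exact: discrete_open.
by exists [:: tt] => z /(_ tt (mem_head _ _)) /ei ->; exact: nbhs_singleton.
Qed.

Lemma coordinates_prod (I J : countType) (T : topologicalType) (c : J -> T -> nat) :
  coordinates c ->
  coordinates (fun (ij : I * J) (y : prod_topology (fun _ : I => T)) => c ij.2 (y ij.1)).
Proof.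
move=> [oc nc]; split.
  move=> [i j] v /=.
  have /(@continuousP (prod_topology (fun _ : I => T)) T) H := @proj_continuous I (fun=> T) i.
  exact: (H _ (oc j v)).
move=> y V yV.
(* The sets containing a cylinder around [y] form a filter. The product topology being a supremum,
   convergence of this filter to [y] can be tested one factor at a time. *)
pose F : set_system (prod_topology (fun _ : I => T)) := [set A | exists s : seq (I * J),
  forall z, {in s, forall ij, c ij.2 (z ij.1) = c ij.2 (y ij.1)} -> A z].
have FF : Filter F.
  split; first by exists [::].
    move=> A A' [s Hs] [s' Hs']; exists (s ++ s') => z Hz; split.
      by apply: Hs => ij ijs; apply: Hz; rewrite mem_cat ijs.
    by apply: Hs' => ij ijs; apply: Hz; rewrite mem_cat ijs orbT.
  by move=> A A' AA' [s Hs]; exists s => z /Hs /AA'.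
suff FV : F --> y by exact: FV.
apply/cvg_sup => i A /= [_ [[W oW <-] Wy] WA].
have [s Hs] := nc _ _ (open_nbhs_nbhs (conj oW Wy)).
exists [seq (i, j) | j <- s] => z Hz; apply: WA; apply: Hs => j js.
by apply: (Hz (i, j)); apply: map_f.
Qed.

Lemma coordinates_pair (T1 T2 : topologicalType) (J1 J2 : countType)
    (c1 : J1 -> T1 -> nat) (c2 : J2 -> T2 -> nat) :
  coordinates c1 -> coordinates c2 ->
  coordinates (fun (j : J1 + J2) (y : T1 * T2) =>
     match j with inl j => c1 j y.1 | inr j => c2 j y.2 end).
Proof.
move=> [C1 n1] [C2 n2]; split.
  case=> j v.
    have /(@continuousP (T1 * T2)%type T1) H : continuous (@fst T1 T2) by move=> y; exact: cvg_fst.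
    exact: (H _ (C1 j v)).
  have /(@continuousP (T1 * T2)%type T2) H : continuous (@snd T1 T2) by move=> y; exact: cvg_snd.
  exact: (H _ (C2 j v)).
move=> [y1 y2] V [[V1 V2] /= [/n1[s1 H1] /n2[s2 H2]] VV].
exists ([seq inl j | j <- s1] ++ [seq inr j | j <- s2]) => -[z1 z2] Hz.
apply: VV; split=> /=.
  by apply: H1 => j js; apply: (Hz (inl j)); rewrite mem_cat map_f.
by apply: H2 => j js; apply: (Hz (inr j)); rewrite mem_cat map_f ?orbT.
Qed.

Lemma coordinates_sub (T : topologicalType) (A : set T) (J : countType)
    (c : J -> T -> nat) :
  coordinates c -> coordinates (fun j (y : A) => c j (set_val y)).
Proof.
move=> [oc nc]; split=> [j v|y V [_ [[W oW <-] Wy] WV]].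
  by exists [set y | c j y = v]; first exact: oc.
have [s Hs] := nc _ _ (open_nbhs_nbhs (conj oW Wy)).
by exists s => z /Hs /WV.
Qed.

Lemma finitely_determined_open (T : topologicalType) (J : countType) (c : J -> T -> nat)
    (F : set T) : coordinates c -> finitely_determined c F -> open F.
Proof.
move=> cT [s Fs].
rewrite (_ : F = \bigcup_(y in F) cylinder c [seq (j, c j y) | j <- s]).
  by apply: bigcup_open => y _; exact: cylinder_open.
apply/seteqP; split=> y /= Fy.
  by exists y => // _ /mapP[j _ ->].
case: Fy => y' Fy' yy'; apply/(Fs y y') => // j js.
exact: (yy' _ (map_f (fun j => (j, c j y')) js)).
Qed.

(** * Shift invariance of the measure *)

Lemma pushforward_probability d d' (T1 : measurableType d) (T2 : measurableType d')
    (R : realType) (m : probability T1 R) (g : T1 -> T2) :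
  measurable_fun setT g ->
  exists P : probability T2 R, forall A, P A = m (g @^-1` A).
Proof.
move=> mg; pose X : {mfun T1 >-> T2} := HB.pack g (isMeasurableFun.Build _ _ _ _ g mg).
by exists (distribution m X).
Qed.

(** The pushforward of [m] by [g] and [m] itself agree on the pi-system of cylinders. *)
Lemma borel_invariant (T : ptopologicalType) (J : countType) (c : J -> T -> nat)
    (R : realType) (m : probability (borel T) R) (g : borel T -> borel T) :
  coordinates c -> measurable_fun setT g ->
  (forall d, m (g @^-1` cylinder c d) = m (cylinder c d)) ->
  forall A : set (borel T), measurable A -> m (g @^-1` A) = m A.
Proof.
move=> cT /(pushforward_probability m)[P PE] H A mA.
have -> : m (g @^-1` A) = P A by rewrite PE.
apply: (borel_prob_eq cT) => //; last by move=> d; exact: etrans (PE _) (H d).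
by rewrite (le_lt_trans (probability_le1 P _)) // ltry.
Qed.

Lemma coordinates_cantor_space :
  coordinates (fun (j : nat * unit) (x : cantor_space) => pickle (x j.1)).
Proof. exact: (@coordinates_prod nat _ _ _
  (@coordinates_discrete bool _ (pcan_inj pickleK))). Qed.

Section ShiftInvariance.
Variables (R : realType) (A : finType) (sigma : A) (l : nat) (B : 'I_l.+1 -> block sigma).

Definition cantor_coord : int * (nat * unit) -> bilateral cantor_space -> nat :=
  fun ij y => pickle (y ij.1 ij.2.1).

Definition symbol_coord (S : countType) (s0 : S) :
    int * unit -> bilateral (pdiscrete s0) -> nat :=
  fun ij y => pickle (y ij.1 : S).

Lemma coordinates_cantor : coordinates cantor_coord.
Proof.
exact: (@coordinates_prod int _ _ _ coordinates_cantor_space).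
Qed.

Lemma coordinates_symbol (S : countType) (s0 : S) :
  coordinates (@symbol_coord S s0).
Proof. exact: (@coordinates_prod int _ _ _
  (@coordinates_discrete (discrete_topology S) _ (pcan_inj (@pickleK S)))). Qed.

Definition config_coord (j : (int * unit + int * (nat * unit)) + int * unit)
    (y : config sigma l) : nat :=
  match j with
  | inl (inl j) => symbol_coord j y.1.1
  | inl (inr j) => cantor_coord j y.1.2
  | inr j => symbol_coord j y.2
  end.

Lemma coordinates_config : coordinates config_coord.
Proof.
have := coordinates_pair (coordinates_pair (coordinates_symbol sigma) coordinates_cantor)
  (coordinates_symbol (ord0 : 'I_l.+1, true)).
by congr coordinates; apply/funext => -[[j|j]|j]; apply/funext.
Qed.

Lemma measurable_coord (T : ptopologicalType) (J : countType) (c : J -> T -> nat) j v :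
  coordinates c -> measurable ([set y | c j y = v] : set (borel T)).
Proof. by move=> cT; apply: sub_sigma_algebra; exact: cT.1. Qed.

Lemma measurable_shift_cantor n :
  measurable_fun setT
    (Defs.shift n : borel (bilateral cantor_space) -> borel (bilateral cantor_space)).
Proof.
apply: (measurable_to_borel coordinates_cantor) => -[i [k []]] v.
exact: (measurable_coord (n + i, (k, tt)) v coordinates_cantor).
Qed.

Lemma measurable_shift_symbol (S : countType) (s0 : S) n :
  measurable_fun setT
    (Defs.shift n : borel (bilateral (pdiscrete s0)) -> borel (bilateral (pdiscrete s0))).
Proof.
apply: (measurable_to_borel (coordinates_symbol s0)) => -[i []] v.
exact: (measurable_coord (n + i, tt) v (coordinates_symbol s0)).
Qed.

Lemma measurable_shift_config n :
  measurable_fun setT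
    (shift_config n : borel (config sigma l) -> borel (config sigma l)).
Proof.
apply: (measurable_to_borel coordinates_config) => -[[[i []]|[i [k []]]]|[i []]] v.
- exact: (measurable_coord (inl (inl (n + i, tt))) v coordinates_config).
- exact: (measurable_coord (inl (inr (n + i, (k, tt)))) v coordinates_config).
- exact: (measurable_coord (inr (n + i, tt)) v coordinates_config).
Qed.

Definition IB_coord (j : int * unit + int * unit) (y : IBspace sigma l) : nat :=
  match j with inl j => symbol_coord j y.1 | inr j => symbol_coord j y.2 end.

Lemma coordinates_IB : coordinates IB_coord.
Proof.
exact: coordinates_pair (coordinates_symbol sigma)
  (coordinates_symbol (ord0 : 'I_l.+1, true)).
Qed.

Lemma measurable_symbol (S : countType) (s0 : S) (i : int) (Q : set S) :
  measurable ([set z | Q (z i)] : set (borel (bilateral (pdiscrete s0)))).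
Proof.
apply: sub_sigma_algebra.
have /(@continuousP (bilateral (pdiscrete s0)) (pdiscrete s0)) H :=
  @proj_continuous int (fun=> pdiscrete s0) i.
exact: (H Q (discrete_open _)).
Qed.

Lemma measurable_readout : measurable_fun setT (@readout A sigma l B).
Proof.
apply: (measurable_to_borel coordinates_IB) => -[[i []]|[i []]] v.
- exact: (@measurable_symbol (state B) (state0 B) i
    (fun s => pickle (beta (B (tag s)) (tagged s)) = v)).
- exact: (@measurable_symbol (state B) (state0 B) i
    (fun s => pickle (tag s, tagged s == 0%N :> nat) = v)).
Qed.

Lemma measurable_reorder : measurable_fun setT (@reorder A sigma l).
Proof.
apply: (measurable_to_borel coordinates_config) => -[[j|j]|j] v.
- rewrite -[X in measurable X]setTI.
  exact: measurable_snd measurableT _ (measurable_coord (inl j) v coordinates_IB).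
- rewrite -[X in measurable X]setTI.
  exact: measurable_fst measurableT _ (measurable_coord j v coordinates_cantor).
- rewrite -[X in measurable X]setTI.
  exact: measurable_snd measurableT _ (measurable_coord (inr j) v coordinates_IB).
Qed.

Lemma is_product_shift (u : probability (borel cantor_space) R)
    (lambda : probability (borel (bilateral cantor_space)) R) n :
  is_product u lambda ->
  forall X : set (borel (bilateral cantor_space)), measurable X -> lambda (Defs.shift n @^-1` X) = lambda X.
Proof.
move=> Hl; apply: (borel_invariant coordinates_cantor (measurable_shift_cantor n)) => d.
(* [is_product] speaks of distinct positions, so all constraints of [d] at one position [i] are
   gathered in a single event [E i]. *)
pose s := undup [seq jv.1.1 | jv <- d].
pose E i : set (borel cantor_space) :=
  [set x | forall jv, jv \in d -> jv.1.1 = i -> pickle (x jv.1.2.1) = jv.2].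
have mE i : measurable (E i).
  rewrite (_ : E i = \bigcap_(jv in [set` [seq jv <- d | jv.1.1 == i]])
      [set x | pickle (x jv.1.2.1) = jv.2]); last first.
    apply/seteqP; split=> x /= H jv.
      by rewrite /= mem_filter => /andP[/eqP ji jd]; exact: H.
    by move=> jd ji; apply: (H jv); rewrite /= mem_filter ji eqxx.
  apply: fin_bigcap_measurable => [|jv _]; first exact: finite_seq.
  exact: (measurable_coord (jv.1.2.1, tt) jv.2 coordinates_cantor_space).
have -> : cylinder cantor_coord d = [set x | forall i, i \in s -> E i (x i)].
  apply/seteqP; split=> x /= H; first by move=> i _ jv /H <- <-.
  move=> jv jd; apply: (H jv.1.1) => //.
  by rewrite mem_undup; exact: (map_f (fun jv => jv.1.1) jd).
(* Shifting only renames positions: the same events are imposed at the positions [n + i]. *)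
have -> : Defs.shift n @^-1` [set x | forall i, i \in s -> E i (x i)] =
    [set x : bilateral cantor_space |
      forall i, i \in [seq n + i | i <- s] -> E (i - n) (x i)].
  apply/seteqP; split=> x /= H i.
    by move=> /mapP[k ks ->]; rewrite addrAC subrr add0r; exact: H.
  by move=> si; have := H (n + i) (map_f (fun k => n + k) si); rewrite addrAC subrr add0r.
have us : uniq [seq n + i | i <- s] by rewrite map_inj_uniq ?undup_uniq //; exact: addrI.
rewrite (Hl s E (undup_uniq _) mE) (Hl _ (fun i => E (i - n)) us) // big_map.
by apply: eq_bigr => i _; rewrite addrAC subrr add0r.
Qed.

Section Windows.
Variables (S : countType) (s0 : S).
Local Notation Z := (bilateral (pdiscrete s0)).

Definition window (N : nat) (z : Z) : seq S := [seq z (k%:Z - N%:Z) | k <- iota 0 (2 * N).+1].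

Lemma windowP N (z z' : Z) :
  window N z = window N z' <->
  forall j, (j <= 2 * N)%N -> z (- N%:Z + j%:Z) = z' (- N%:Z + j%:Z).
Proof.
split=> [/eq_in_map H j jN|H]; first by rewrite addrC; apply: H; rewrite mem_iota.
by apply/eq_in_map => k; rewrite mem_iota => /H; rewrite addrC.
Qed.

Lemma window_le N M (z z' : Z) : (N <= M)%N ->
  window M z = window M z' -> window N z = window N z'.
Proof.
move=> NM /windowP H; apply/windowP => j jN.
by have := H (j + (M - N))%N; rewrite (_ : - M%:Z + _ = - N%:Z + j%:Z); [apply|]; lia.
Qed.

(* The Markov property only gives the measure of interval cylinders; for these
   coordinates every nonempty proper cylinder is one. *)
Lemma coordinates_window : coordinates (fun N (z : Z) => pickle (window N z)).
Proof.
have [_ nc] := coordinates_symbol s0; split=> [N v|y V /nc[s Hs]].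
  have [[z0 z0v]|no] := pselect (exists z0, pickle (window N z0) = v).
    rewrite (_ : [set y | _] = cylinder (@symbol_coord S s0)
        [seq ((k%:Z - N%:Z, tt), pickle (z0 (k%:Z - N%:Z) : S)) | k <- iota 0 (2 * N).+1]).
      exact: cylinder_open (coordinates_symbol s0) _.
    rewrite -z0v; apply/seteqP; split=> z; rewrite /mkset.
      move=> /(pcan_inj pickleK) /eq_in_map H jv /mapP[k ks ->] /=.
      by rewrite /symbol_coord /= H.
    move=> H; congr pickle; apply/eq_in_map => k ks.
    apply: (pcan_inj pickleK).
    exact: (H _ (map_f (fun k : nat => ((k%:Z - N%:Z, tt), pickle (z0 (k%:Z - N%:Z) : S))) ks)).
  rewrite (_ : [set y | _] = set0); first exact: open0.
  by apply/seteqP; split=> // z zv; apply: no; exists z.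
(* A single window suffices, wide enough to contain all positions of [s]. *)
exists [:: (\max_(j <- s) `|j.1|)%N] => z /(_ _ (mem_head _ _)).
move=> /(pcan_inj pickleK) /windowP H; apply: Hs => -[i []] js.
rewrite /symbol_coord /=; congr pickle.
have iN : (`|i| <= \max_(j <- s) `|j.1|)%N by exact: (@leq_bigmax_seq _ _ xpredT (fun j : int * unit => `|j.1|%N) (i, tt)).
move: (\max_(j <- s) _)%N H iN => N H iN {js}.
have iE : - N%:Z + (absz ((i : int) + N%:Z)%R)%:Z = (i : int).
  by move: (i : int) iN => k; lia.
have := H (absz ((i : int) + N%:Z)%R); rewrite iE; apply.
by move: (i : int) iN {iE} => k; lia.
Qed.
End Windows.

(** A cylinder of windows, unless empty or the whole space, prescribes one word at consecutive
    times, and the Markov formula for its measure does not mention the starting time. *)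
Lemma markov_shift (S : countType) (s0 : S) (q : S -> R) (tr : S -> S -> R)
    (m : probability (borel (bilateral (pdiscrete s0))) R) n :
  is_markov q tr m ->
  forall X : set (borel (bilateral (pdiscrete s0))), measurable X ->
    m (Defs.shift n @^-1` X) = m X.
Proof.
move=> Hm; apply: (borel_invariant (coordinates_window s0) (measurable_shift_symbol n)) => d.
have [[z0 z0d]|no] := pselect (exists z, cylinder (fun N z => pickle (@window S s0 N z)) d z);
    last first.
  rewrite (_ : cylinder _ d = set0) ?preimage_set0 //.
  by apply/seteqP; split=> // z zd; apply: no; exists z.
(* [N] is the widest window constrained by [d]. As [z0] meets all constraints, agreeing with [z0] on
   this window implies the others. *)
have [d0|[N [jd Nd]]] : d = [::] \/ exists N, N \in [seq jv.1 | jv <- d] /\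
    (forall jv, jv \in d -> (jv.1 <= N)%N).
  elim: d {z0d} => [|jv d IHd]; first by left.
  right; case: IHd => [->|[N [Nd H]]].
    by exists jv.1; split=> [|jv']; rewrite ?mem_head // inE => /eqP ->.
  exists (maxn jv.1 N); split=> [|jv']; last first.
    by rewrite inE => /predU1P[->|/H]; rewrite ?leq_maxl // leq_max orbC => ->.
  by rewrite /maxn inE; case: ltnP; rewrite ?eqxx // Nd orbT.
  by rewrite d0 (_ : cylinder _ [::] = setT) ?preimage_setT //; apply/seteqP; split.
have -> : cylinder (fun N z => pickle (@window S s0 N z)) d =
    [set z | forall j, (j <= 2 * N)%N -> z (- N%:Z + j%:Z) = z0 (- N%:Z + j%:Z)].
  apply/seteqP; split=> z /= H.
    apply/windowP; have /mapP[jv jvd ->] := jd.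
    by apply: (pcan_inj pickleK); rewrite (H _ jvd) (z0d _ jvd).
  move=> jv jvd; rewrite -(z0d _ jvd); congr pickle.
  by apply: (window_le (Nd _ jvd)); apply/windowP.
rewrite (Hm (- N%:Z) (2 * N)%N (fun j => z0 (- N%:Z + j%:Z))).
rewrite -(Hm (n - N%:Z) (2 * N)%N (fun j => z0 (- N%:Z + j%:Z))); congr (m _).
by apply/seteqP; split=> z /= H j /H <-; rewrite /Defs.shift addrA.
Qed.

End ShiftInvariance.

Section NuInvariance.
Variables (R : realType) (A : finType) (sigma : A) (l : nat) (B : 'I_l.+1 -> block sigma).
Variables (u : probability (borel cantor_space) R).
Variables (lambda : probability (borel (bilateral cantor_space)) R).
Variable m : probability (borel (bilateral (pdiscrete (state0 B)))) R.
Hypotheses (Hlambda : is_product u lambda) (Hm : chain_law m).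

(** [nu] is a bare set function, hence the bundled [P]. Invariance is checked on rectangles, where
    it splits into that of [lambda] and that of [mu m]; uniqueness of the product measure does the
    rest. *)
Lemma nu_shift_invariant_probability :
  exists P : probability (borel (config sigma l)) R,
    (P = nu lambda m :> (set (borel (config sigma l)) -> \bar R)) /\
    forall n (X : set (borel (config sigma l))), measurable X ->
      P (shift_config n @^-1` X) = P X.
Proof.
have [Pmu PmuE] := pushforward_probability m (@measurable_readout A sigma l B).
have PmuE' : mu m = Pmu by apply/funext => X; rewrite /mu /pushforward -PmuE.
have [P PE] := pushforward_probability (lambda \x Pmu)%E (@measurable_reorder A sigma l).
exists P; split; first by apply/funext => X; rewrite /nu /pushforward PmuE' -PE.
move=> n X mX.
pose S2 (y : borel (IBspace sigma l)) : borel (IBspace sigma l) :=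
  (Defs.shift n y.1, Defs.shift n y.2).
pose S (y : borel (bilateral cantor_space) * borel (IBspace sigma l)) :=
  (Defs.shift n y.1 : borel (bilateral cantor_space), S2 y.2).
have mS2 : measurable_fun setT S2.
  apply: (measurable_to_borel (@coordinates_IB A sigma l)) => -[[i []]|[i []]] v.
  - exact: (measurable_coord (inl (n + i, tt)) v (@coordinates_IB A sigma l)).
  - exact: (measurable_coord (inr (n + i, tt)) v (@coordinates_IB A sigma l)).
have mS : measurable_fun setT S.
  apply/measurable_fun_pairP; split => /=.
    exact: (measurableT_comp (measurable_shift_cantor n) measurable_fst).
  exact: (measurableT_comp mS2 measurable_snd).
(* [readout] commutes with the shift, so invariance passes from the chain to its image. *)
have Pmu_shift X2 : measurable X2 -> Pmu (S2 @^-1` X2) = Pmu X2.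
  move=> mX2; rewrite !PmuE; apply: (markov_shift n Hm (X := readout (B := B) @^-1` X2)).
  by rewrite -[X in measurable X]setTI; exact: measurable_readout.
have [P' P'E] := pushforward_probability (lambda \x Pmu)%E mS.
have mrX : measurable (@reorder A sigma l @^-1` X).
  by rewrite -[X in measurable X]setTI; exact: measurable_reorder.
(* [reorder] intertwines [S] with [shift_config n], so the claim becomes the invariance of the
   product measure under [S]. *)
rewrite !PE; transitivity (P' (@reorder A sigma l @^-1` X)); first by rewrite P'E.
symmetry; apply: (product_measure_unique) => // X1 X2 mX1 mX2.
transitivity ((lambda \x Pmu)%E (S @^-1` (X1 `*` X2))); first exact: P'E.
rewrite (_ : S @^-1` _ = (Defs.shift n @^-1` X1) `*` (S2 @^-1` X2)) //.
rewrite product_measure1E.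
- by congr (_ * _)%E; [exact: (is_product_shift n Hlambda mX1)|exact: Pmu_shift].
- by rewrite -[X in measurable X]setTI; exact: measurable_shift_cantor.
- by rewrite -[X in measurable X]setTI; exact: mS2.
Qed.

End NuInvariance.

(** * Approximation by finitely determined sets *)

Section Approximation.
Variables (R : realType) (T : ptopologicalType) (J : countType) (c : J -> T -> nat).
Hypothesis cT : coordinates c.
Variable P : probability (borel T) R.

Definition approximable (E : set (borel T)) : Prop :=
  measurable E /\ forall e : R, 0 < e -> exists F : set (borel T),
    [/\ measurable F, finitely_determined c F & (P (E `+` F) <= e%:E)%E].

Lemma measurable_setY (E F : set (borel T)) :
  measurable E -> measurable F -> measurable (E `+` F).
Proof. by move=> mE mF; apply: measurableU; exact: measurableD. Qed.

Lemma approximable_cylinder d : approximable (cylinder c d).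
Proof.
have mc : measurable (cylinder c d : set (borel T)).
  by apply: sub_sigma_algebra; exact: cylinder_open.
split=> // e e0; exists (cylinder c d); split=> //; last first.
  by rewrite setYK measure0 lee_fin ltW.
exists [seq jv.1 | jv <- d] => y y' yy'; split=> H jv jd.
  by rewrite -(yy' _ (map_f fst jd)) H.
by rewrite (yy' _ (map_f fst jd)) H.
Qed.

Lemma approximable_setC E : approximable E -> approximable (~` E).
Proof.
move=> [mE aE]; split; first exact: measurableC.
move=> e /aE[F [mF [s Fs] EF]]; exists (~` F); split; first exact: measurableC.
  by exists s => y y' /Fs; rewrite /setC /=; tauto.
rewrite (_ : _ `+` _ = E `+` F) //.
by apply/seteqP; split=> y; rewrite /setY /setD /setU /setC /=; case: (pselect (E y)); case: (pselect (F y)); tauto.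
Qed.

Lemma approximable_setU E E' :
  approximable E -> approximable E' -> approximable (E `|` E').
Proof.
move=> [mE aE] [mE' aE']; split; first exact: measurableU.
move=> e e0; have e20 : 0 < e / 2 by rewrite divr_gt0.
have [F [mF [s Fs] EF]] := aE _ e20; have [F' [mF' [s' Fs'] EF']] := aE' _ e20.
exists (F `|` F'); split; first exact: measurableU.
  exists (s ++ s') => y y' yy'.
  have H : F y <-> F y' by apply: Fs => j js; apply: yy'; rewrite mem_cat js.
  have H' : F' y <-> F' y' by apply: Fs' => j js; apply: yy'; rewrite mem_cat js orbT.
  by rewrite /setU /=; tauto.
rewrite (@le_trans _ _ (P ((E `+` F) `|` (E' `+` F')))) //.
  apply: le_measure; rewrite ?inE; try by repeat apply: measurable_setY || apply: measurableU.
  by move=> y; rewrite /setY /setD /setU /=; tauto.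
rewrite (le_trans (measureU2 _ _ _)) //; try exact: measurable_setY.
by rewrite [leRHS](_ : _ = (e / 2)%:E + (e / 2)%:E)%E ?leeD // -EFinD -splitr.
Qed.

(** Half of the error pays for cutting the union to finitely many sets, by continuity from above;
    the other half pays for approximating that finite union. *)
Lemma approximable_bigcup (E : (set (borel T))^nat) :
  (forall i, approximable (E i)) -> approximable (\bigcup_i E i).
Proof.
move=> aE; have mE i : measurable (E i) by case: (aE i).
have mU : measurable (\bigcup_i E i) by exact: bigcupT_measurable.
split=> // e e0; have e20 : 0 < e / 2 by rewrite divr_gt0.
pose G n := \big[setU/set0]_(i < n) E i.
have aG n : approximable (G n).
  rewrite /G; elim: n => [|n IHn]; last by rewrite big_ord_recr /=; exact: approximable_setU.
  rewrite big_ord0 -setCT; apply: approximable_setC.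
  by have := approximable_cylinder [::]; congr approximable; apply/seteqP; split.
have mG n : measurable (G n) by case: (aG n).
have [n Gn] : exists n, (P (\bigcup_i E i `\` G n) <= (e / 2)%:E)%E.
  apply: contrapT => /forallNP H.
  have : P (\bigcup_i E i `\` G n) @[n --> \oo] --> P (\bigcap_n (\bigcup_i E i `\` G n)).
    apply: nonincreasing_cvg_mu.
    - by rewrite (le_lt_trans (probability_le1 P _)) ?ltry //; exact: measurableD.
    - by move=> i; exact: measurableD.
    - by apply: bigcapT_measurable => i; exact: measurableD.
    - move=> i j ij; apply/subsetPset; apply: setDS.
      exact: subset_bigsetU.
  rewrite (_ : \bigcap_n _ = set0) ?measure0 => [H0|]; last first.
    apply/seteqP; split=> // y H1; have [[i _ Eiy] _] := H1 0%N I.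
    have [_] := H1 i.+1 I; apply; rewrite /G -bigcup_mkord.
    by exists i => /=.
  have : ((e / 2)%:E <= limn (fun n => P (\bigcup_i E i `\` G n)))%E.
    apply: lime_ge; first by apply/cvg_ex; exists 0%E.
    by apply: nearW => i; apply/ltW; rewrite ltNge; apply/negP; exact: H.
  by rewrite (cvg_lim _ H0) // lee_fin leNgt e20.
have [F [mF Fs GF]] := (aG n).2 _ e20.
exists F; split=> //.
rewrite (@le_trans _ _ (P ((\bigcup_i E i `\` G n) `|` (G n `+` F)))) //.
  apply: le_measure; rewrite ?inE.
  - exact: measurable_setY.
  - by apply: measurableU; [exact: measurableD|exact: measurable_setY].
  have GU : G n `<=` \bigcup_i E i.
    exact: bigsetU_bigcup.
  move=> y; have := GU y; rewrite /setY /setD /setU /=.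
  by case: (pselect (G n y)); tauto.
rewrite (le_trans (measureU2 _ _ _)) //; [exact: measurableD|exact: measurable_setY|].
by rewrite [leRHS](_ : _ = (e / 2)%:E + (e / 2)%:E)%E ?leeD // -EFinD -splitr.
Qed.

(** The approximable sets form a sigma-algebra containing the cylinders. *)
Lemma measurable_approximable (E : set (borel T)) : measurable E -> approximable E.
Proof.
rewrite /measurable /= (sigma_open_cylinder cT).
apply: smallest_sub => [|_ [d _ <-]]; last exact: approximable_cylinder.
split.
- rewrite -setCT; apply: approximable_setC.
  by have := approximable_cylinder [::]; congr approximable; apply/seteqP; split.
- by move=> E'; rewrite setTD; exact: approximable_setC.
- exact: approximable_bigcup.
Qed.

End Approximation.

(** * Events read off a tail of the configuration *)

Section TailDetermined.
Variables (R : realType) (A : finType) (sigma : A) (l : nat).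
Local Notation X := (borel (config sigma l)).
Variable P : probability X R.
Hypothesis Pshift : forall n (E : set X), measurable E -> P (shift_config n @^-1` E) = P E.

Definition agree (J : set int) (y y' : config sigma l) : Prop :=
  forall n, J n -> [/\ inp y n = inp y' n, rnd y n = rnd y' n & lab y n = lab y' n].

Definition config_pos (j : (int * unit + int * (nat * unit)) + int * unit) : int :=
  match j with inl (inl j) => j.1 | inl (inr j) => j.1 | inr j => j.1 end.

Lemma agree_config_coord (J : set int) (y y' : config sigma l) j :
  agree J y y' -> J (config_pos j) -> config_coord j y = config_coord j y'.
Proof.
by case: j => [[[i []]|[i [k []]]]|[i []]] H /H[];
  rewrite /inp /rnd /lab /config_coord /symbol_coord /cantor_coord /= => E1 E2 E3;
  rewrite ?E1 ?E2 ?E3.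
Qed.

Lemma finitely_determined_window (F : set (config sigma l)) :
  finitely_determined (@config_coord A sigma l) F ->
  exists N : nat, forall y y', agree [set i : int | (absz i <= N)%N] y y' -> F y <-> F y'.
Proof.
move=> [s Fs]; exists (\max_(j <- s) absz (config_pos j)) => y y' yy'.
apply: Fs => j js; apply: (agree_config_coord yy').
exact: (@leq_bigmax_seq _ _ xpredT (fun j => absz (config_pos j)) j).
Qed.

(** Approximate [E] within 2^-(k+1) by an event seen in the window of radius [N k]. By shift
    invariance the error at time [n k] has the same measure, so by Borel-Cantelli almost every
    configuration is eventually free of error, and membership at time [n k] is then read off [J].
    The radii come first, so that the times can be chosen with all windows inside [J]. *)
Lemma tail_determined (E : set X) : measurable E ->
  exists N : nat -> nat, forall (n : nat -> int) (J : set int),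
    (forall k i, (absz i <= N k)%N -> J (n k + i)) ->
    exists2 Z : set X, P.-negligible Z &
      forall y y', ~ Z y -> ~ Z y' -> agree J y y' ->
        exists k0, forall k, (k0 <= k)%N ->
          E (shift_config (n k) y) <-> E (shift_config (n k) y').
Proof.
move=> mE; have [_ aE] := measurable_approximable (@coordinates_config A sigma l) P mE.
have /choice[FN HFN] : forall k, exists FN : set X * nat, [/\ measurable FN.1,
    forall y y', agree [set i : int | (absz i <= FN.2)%N] y y' -> FN.1 y <-> FN.1 y' &
    (P (E `+` FN.1) <= (1 / (2 ^ k.+1)%:R)%:E)%E].
  move=> k; have [|F [mF /finitely_determined_window[N FN] EF]] := aE (1 / (2 ^ k.+1)%:R).
    by rewrite divr_gt0 // ltr0n expn_gt0.
  by exists (F, N).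
exists (fun k => (FN k).2) => n J HJ.
(* At time [n k] the approximation misjudges exactly the configurations in [W k]; the exceptional
   set is the limsup of these. *)
pose W k : set X := shift_config (n k) @^-1` (E `+` (FN k).1).
have mS k (D : set X) : measurable D -> measurable (shift_config k @^-1` D : set X).
  by move=> mD; rewrite -[Y in measurable Y]setTI; exact: measurable_shift_config.
have mEF k : measurable (E `+` (FN k).1).
  by case: (HFN k) => mF _ _; exact: measurable_setY.
have mW k : measurable (W k) by exact: mS.
exists (lim_sup_set W).
  apply/negligibleP.
    apply: bigcapT_measurable => k; apply: bigcup_measurable => j _; exact: mW.
  apply: lim_sup_set_cvg0 => //.
  apply: (@le_lt_trans _ _ (\sum_(k <oo) (1 / (2 ^ k.+1)%:R)%:E)%E).
    apply: lee_nneseries => // k _; have [_ _ H] := HFN k.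
    by apply: le_trans H; rewrite le_eqVlt; apply/orP; left; apply/eqP; exact: Pshift.
  by rewrite (le_lt_trans (epsilon_trick0 _ _)) // ltry.
move=> y y' Zy Zy' yy'.
have lim0 z : ~ lim_sup_set W z -> exists k0, forall k, (k0 <= k)%N -> ~ W k z.
  move=> /existsNP[k0] /not_implyP[_ H]; exists k0 => k k0k Wz; apply: H.
  by exists k.
have [k0 H0] := lim0 _ Zy; have [k1 H1] := lim0 _ Zy'.
exists (maxn k0 k1) => k; rewrite geq_max => /andP[/H0 + /H1].
have [_ FNk _] := HFN k.
have : (FN k).1 (shift_config (n k) y) <-> (FN k).1 (shift_config (n k) y').
  apply: FNk => i iN; have [E1 E2 E3] := yy' _ (HJ k i iN).
  by split.
rewrite /W /setY /setD /setU /preimage /=.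
have := pselect (E (shift_config (n k) y)); have := pselect (E (shift_config (n k) y')).
have := pselect ((FN k).1 (shift_config (n k) y)).
by have := pselect ((FN k).1 (shift_config (n k) y')); clear; tauto.
Qed.

End TailDetermined.

(** * Block structure and the induced labels *)

Lemma int_step (Q : int -> Prop) (a b : int) :
  (forall j, a <= j -> j < b -> Q j -> Q (j + 1)) -> a <= b -> Q a -> Q b.
Proof.
move=> H ab Qa; have [n nE] : exists n : nat, b = a + n%:Z by exists (absz (b - a)); lia.
subst b; clear ab.
elim: n H => [|n IHn] H; first by rewrite addr0.
rewrite (_ : a + n.+1%:Z = a + n%:Z + 1); last by lia.
by apply: (H); [lia|lia|apply: IHn => j aj jn; apply: H; lia].
Qed.

Section Blocks.
Variables (A : finType) (sigma : A) (l : nat) (B : 'I_l.+1 -> block sigma).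
Implicit Types y : config sigma l.

Definition block_length y (i : int) : nat := blen (B (lab y i).1).

(** The last clause flags the endpoint as the start of a further block, so that copies can be
    chained. *)
Definition block_at y (i : int) : Prop :=
  [/\ forall r : nat, (r <= block_length y i)%N ->
        inp y (i + r%:Z) = beta (B (lab y i).1) r,
      forall r : nat, (r < block_length y i)%N ->
        lab y (i + r%:Z) = ((lab y i).1, r == 0%N) &
      (lab y (i + (block_length y i)%:Z)).2].

(** Local form of [concatenation]: holding at every [j] is equivalent to it, while each instance
    depends on a bounded window. Both the G-delta description of [Kset] and the gluing rest on this
    form. *)
Definition covered y (j : int) : Prop :=
  exists i, [/\ i <= j, j < i + (block_length y i)%:Z & block_at y i].

Lemma block_length_gt0 y i : (0 < block_length y i)%N.
Proof. exact: blen_gt0. Qed.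

Lemma block_at_start y i : block_at y i -> (lab y i).2.
Proof.
by case=> _ /(_ 0%N (block_length_gt0 y i)) + _; rewrite addr0 => ->.
Qed.

Lemma block_at_lab y i j : block_at y i -> i <= j -> j < i + (block_length y i)%:Z ->
  lab y j = ((lab y i).1, j == i).
Proof.
move=> [_ H _] ij ji; have := H (absz (j - i)).
rewrite (_ : i + _ = j); last by lia.
move=> ->; last by lia.
by congr (_, _); apply/eqP/eqP; lia.
Qed.

Lemma covered_start y i : covered y i -> (lab y i).2 -> block_at y i.
Proof.
by move=> [i' [i'i ii' b]]; rewrite (block_at_lab b i'i ii') /= => /eqP ->.
Qed.

Lemma block_end y i j : block_at y i -> i < j -> j <= i + (block_length y i)%:Z ->
  (lab y j).2 -> j = i + (block_length y i)%:Z.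
Proof.
move=> b ij ji; have [//|jlt] : j = i + (block_length y i)%:Z \/ j < i + (block_length y i)%:Z by lia.
by rewrite (block_at_lab b (ltW ij) jlt) /= => /eqP; lia.
Qed.

Lemma concatenation_covered y : concatenation B y -> forall j, covered y j.
Proof.
move=> [s [k sk]] j.
have kE t : (lab y (s t)).1 = k t.
  by have [_ _ /(_ 0%N (blen_gt0 _))] := sk t; rewrite addr0 => ->.
have st (t : int) : block_at y (s t) /\ s (t + 1) = s t + (block_length y (s t))%:Z.
  have [E1 E2 E3] := sk t; rewrite /block_at /block_length kE; split=> //; split=> //.
  rewrite -E1; have [_ _ /(_ 0%N (blen_gt0 _))] := sk (t + 1).
  by rewrite addr0 => ->.
have inc (t : int) : s t + 1 <= s (t + 1).
  by have [_ ->] := st t; have := block_length_gt0 y (s t); lia.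
have incn (t : int) (n : nat) : s t + n%:Z <= s (t + n%:Z).
  elim: n => [|n IHn]; first by rewrite !addr0.
  by have := inc (t + n%:Z); rewrite (_ : t + n%:Z + 1 = t + n.+1%:Z); lia.
(* Starts advance by at least one per block, so [absz (j - s 0)] blocks before [s 0] the start is at
   or before [j]. *)
pose t0 : int := - (absz (j - s 0))%:Z.
have t0j : s t0 <= j.
  have : s t0 + (absz (j - s 0))%:Z <= s 0 by have := incn t0 (absz (j - s 0)); rewrite {2}/t0 addNr.
  by move: (s t0) (s 0) => a b; lia.
have ex : exists n : nat, j < s (t0 + n%:Z).
  by exists (absz (j - s t0)).+1; apply: lt_le_trans (incn _ _); lia.
case: (ex_minnP ex) => -[|n] nj nmin; first by move: nj; rewrite addr0 ltNge t0j.
have [b E] := st (t0 + n%:Z).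
exists (s (t0 + n%:Z)); split=> //; last first.
  by rewrite -E (_ : t0 + n%:Z + 1 = t0 + n.+1%:Z) //; lia.
by rewrite leNgt; apply/negP => /nmin; rewrite ltnn.
Qed.

Lemma covered_concatenation y : (forall j, covered y j) -> concatenation B y.
Proof.
move=> cov; have [i0 [_ _ b0]] := cov 0.
pose next i := i + (block_length y i)%:Z.
have bnext i : block_at y i -> block_at y (next i).
  by move=> b; apply: covered_start (cov _) _; case: b.
(* A block covering [i - 1] must end at [i], since a block carries a start flag only at its first
   position and [i] is flagged. *)
have /choice[prev prevP] : forall i, exists i', block_at y i ->
    block_at y i' /\ next i' = i.
  move=> i; have [b|nb] := pselect (block_at y i); last by exists i.
  have [i' [i'i ii' b']] := cov (i - 1); exists i' => _; split=> //.
  by rewrite /next -(block_end b' _ _ (block_at_start b)); lia.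
pose s (t : int) := match t with Posz n => iter n next i0 | Negz n => iter n.+1 prev i0 end.
have sb t : block_at y (s t).
  case: t => n; rewrite /s; first by elim: n => //= n IHn; exact: bnext.
  by elim: n.+1 => //= k IHk; case: (prevP _ IHk).
have sS t : s (t + 1) = next (s t).
  case: t => [n|[|n]].
  - by rewrite (_ : n%:Z + 1 = n.+1%:Z) //; lia.
  - by rewrite (_ : Negz 0 + 1 = 0%:Z) //=; case: (prevP _ b0) => _ ->.
  - rewrite (_ : Negz n.+1 + 1 = Negz n); last by lia.
    by have := prevP _ (sb (Negz n)) => -[_] {1}<-.
exists s, (fun t => (lab y (s t)).1) => t; have [b1 b2 b3] := sb t.
by split; [rewrite sS|exact: b1|exact: b2].
Qed.

Lemma block_at_shift n y i : block_at (shift_config n y) i <-> block_at y (n + i).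
Proof.
by rewrite /block_at /block_length /inp /lab /= /Defs.shift; split=> -[b1 b2 b3];
  split=> [r /b1|r /b2|]; rewrite ?addrA // -addrA.
Qed.

End Blocks.

Section StartsInK.
Variables (Pi : lcl) (sigma : Sin Pi) (l : nat) (B : 'I_l.+1 -> block sigma).
Implicit Types y : Kset B.

Definition next_start y (j : int) : int :=
  last_start y j + (block_length B (set_val y) (last_start y j))%:Z.

Lemma Kset_inj (y z : Kset B) : set_val y = set_val z -> y = z.
Proof. by move/val_inj. Qed.

Lemma Kset_covered y j : covered B (set_val y) j.
Proof. by case: (set_mem (valP y)) => /concatenation_covered. Qed.

Lemma last_start_eq y i j : block_at B (set_val y) i -> i <= j ->
  j < i + (block_length B (set_val y) i)%:Z -> last_start y j = i.
Proof.
move=> b ij ji; rewrite /last_start; apply: xget_unique => /=.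
  split=> //; first exact: block_at_start b.
  move=> k /andP[ik kj]; rewrite (block_at_lab b (ltW ik) (le_lt_trans kj ji)) /=.
  by apply/negbTE; rewrite gt_eqF.
move=> i' [i'j si' H]; have [ii'|i'i|//] := ltgtP i i'.
  move: si'; rewrite (block_at_lab b (ltW ii') (le_lt_trans i'j ji)) /= => /eqP E.
  by move: ii'; rewrite E ltxx.
by have := block_at_start b; rewrite H // i'i ij.
Qed.

Lemma last_startP y j :
  [/\ last_start y j <= j,
      j < next_start y j &
      block_at B (set_val y) (last_start y j)].
Proof. by have [i [ij ji b]] := Kset_covered y j; rewrite /next_start (last_start_eq b). Qed.

Lemma last_start_lab y j :
  lab (set_val y) j = ((lab (set_val y) (last_start y j)).1, j == last_start y j).
Proof. by have [ij ji b] := last_startP y j; exact: (block_at_lab b). Qed.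

Lemma last_start_self y i : (lab (set_val y) i).2 -> last_start y i = i.
Proof. by rewrite last_start_lab /= => /eqP. Qed.

Lemma last_startS y j :
  last_start y (j + 1) = if j + 1 == next_start y j then next_start y j else last_start y j.
Proof.
have [ij ji b] := last_startP y j.
case: eqP => [je|je]; first by rewrite je last_start_self //; case: b.
by apply: (last_start_eq b); rewrite -/(next_start y j); lia.
Qed.

Lemma last_startS_start y j : (lab (set_val y) (j + 1)).2 = (j + 1 == next_start y j).
Proof.
have [ij ji b] := last_startP y j.
rewrite last_start_lab /= last_startS.
by case: (j + 1 =P next_start y j) => [->|_]; rewrite ?eqxx //; apply/eqP; lia.
Qed.

Lemma last_start_shift n y j : last_start (shiftK n y) j = last_start y (n + j) - n.
Proof.
have [ij ji b] := last_startP y (n + j).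
apply: last_start_eq; first by apply/block_at_shift; rewrite addrC subrK.
  by lia.
rewrite (_ : block_length _ _ _ = block_length B (set_val y) (last_start y (n + j))).
  by rewrite /next_start in ji; lia.
by rewrite /block_length /lab /= /Defs.shift addrC subrK.
Qed.

Lemma last_start_past y y' j : (forall i, i <= j -> lab (set_val y) i = lab (set_val y') i) ->
  last_start y j = last_start y' j.
Proof.
move=> H; congr xget; apply/seteqP; split=> i [ij si Hi]; split=> //.
- by rewrite -H.
- by move=> k /andP[ik kj]; rewrite -H // Hi // ik.
- by rewrite H.
- by move=> k /andP[ik kj]; rewrite H // Hi // ik.
Qed.

End StartsInK.

(** * Labels at block starts and their classes *)

Section Labels.
Variables (Pi : lcl) (sigma : Sin Pi) (U : subpartition (Sout Pi)).
Variables (l : nat) (B : 'I_l.+1 -> block sigma) (p : 'I_l.+1 -> {perm nclass U}).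
Hypothesis hB : forall i, permutation_block (B i) (p i).
Variable f : Kset B -> bilateral (discrete_topology (Sout Pi)).
Implicit Types y : Kset B.

(** This is q(j) of the overview. *)
Definition start_label y (j : int) : Sout Pi := f y (last_start y j).

Definition constant_Pclass y : Prop :=
  forall j, Pclass U (start_label y j) = Pclass U (start_label y (j + 1)).

Lemma start_label_shift n y : equivariant f ->
  start_label (shiftK n y) 0 = start_label y n.
Proof.
by move=> Hf; rewrite /start_label Hf /Defs.shift last_start_shift addr0 addrC subrK.
Qed.

Lemma Cset_shift n y : equivariant f -> Cset f y -> Cset f (shiftK n y).
Proof.
by move=> Hf Cy k; rewrite Hf; have := Cy (n + k); rewrite /inp /= /Defs.shift -addrA.
Qed.

Lemma block_at_type y i : Cset f y -> block_at B (set_val y) i ->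
  block_type (B (lab (set_val y) i).1)
    (f y i, f y (i + (block_length B (set_val y) i)%:Z)).
Proof.
move=> Cy [b1 _ _]; exists (fun r => f y (i + r%:Z)); split=> //=; first by rewrite addr0.
move=> r rB; rewrite -(b1 r (ltnW rB)) -(b1 r.+1 rB).
by rewrite (_ : r.+1%:Z = r%:Z + 1) ?addrA //; lia.
Qed.

Lemma Pclass_partition (a : Sout Pi) :
  Pclass U a \in equivalence_partition (PP U) [set: Sout Pi]%SET.
Proof.
by apply/imsetP; exists a; rewrite ?finset.inE //; apply/setP => w; rewrite !finset.inE.
Qed.

Lemma prec_Pclass_anti (a b : Sout Pi) : prec U (Pclass U a) (Pclass U b) ->
  prec U (Pclass U b) (Pclass U a) -> Pclass U a = Pclass U b.
Proof.
move=> ab ba; apply: (prec_anti (Pclass_partition a) (Pclass_partition b)).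
by rewrite ab.
Qed.

Lemma start_label_step y j : Cset f y ->
  j + 1 = next_start y j -> block_type (B (lab (set_val y) j).1) (start_label y j, start_label y (j + 1)).
Proof.
move=> Cy je; have [_ _ b] := last_startP y j.
rewrite last_start_lab /= /start_label last_startS je eqxx.
exact: block_at_type.
Qed.

Lemma prec_start_label y j : Cset f y ->
  prec U (Pclass U (start_label y j)) (Pclass U (start_label y (j + 1))).
Proof.
move=> Cy; have [je|je] := (j + 1 =P next_start y j).
  exact: (pb_prec (hB _) (start_label_step Cy je)).
rewrite /start_label last_startS; case: (j + 1 =P next_start y j) => // _.
exact: (prec_refl (Pclass_partition _)).
Qed.

Lemma prec_start_label_le y j j' : Cset f y -> j <= j' ->
  prec U (Pclass U (start_label y j)) (Pclass U (start_label y j')).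
Proof.
move=> Cy jj'; pose Q k := prec U (Pclass U (start_label y j)) (Pclass U (start_label y k)).
apply: (int_step (Q := Q) _ jj'); last exact: (prec_refl (Pclass_partition _)).
move=> k _ _ jk; apply: (prec_trans _ _ _ jk (prec_start_label k Cy));
  exact: Pclass_partition.
Qed.

Lemma constant_PclassE y : constant_Pclass y ->
  forall j j', Pclass U (start_label y j) = Pclass U (start_label y j').
Proof.
move=> cy; suff H j j' : j <= j' -> Pclass U (start_label y j) = Pclass U (start_label y j').
  by move=> j j'; case: (leP j j') => [/H//|/ltW/H].
move=> jj'; apply: (int_step (Q := fun k => Pclass U (start_label y j) =
  Pclass U (start_label y k)) _ jj') => // k _ _ ->; exact: cy.
Qed.

Lemma constant_Pclass_Sset y : Cset f y -> constant_Pclass y -> Sset U f y.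
Proof.
move=> Cy /constant_PclassE cy; split=> // -[i [j [si sj]]]; apply.
by have := cy i j; rewrite /start_label !last_start_self.
Qed.

(** For a letter outside [sdom U], condition (3) of a permutation block would force another P-class
    at the next start, against constancy. *)
Lemma start_label_sdom y j : Cset f y -> constant_Pclass y ->
  start_label y j \in sdom U.
Proof.
move=> Cy cy; apply: contrapT => /negP nd; have [_ _ b] := last_startP y j.
have [_ _ e] := b; apply: (pb_notin (hB _) nd (block_at_type Cy b)).
have := constant_PclassE cy j (next_start y j).
by rewrite {2}/start_label last_start_self.
Qed.

Lemma nclass_of_eq (a b : Sout Pi) (aD : a \in sdom U) (bD : b \in sdom U) :
  nclass_of aD = nclass_of bD <-> nablaset U a = nablaset U b.
Proof. by split=> [/(congr1 val)|E]; [|apply: val_inj]. Qed.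

(** At a common block end the same permutation acts on both classes, and it is injective; elsewhere
    nothing changes. The right-to-left direction serves the future, the other one the past. *)
Lemma Lambda_step y y' j : Cset f y -> Cset f y' -> constant_Pclass y -> constant_Pclass y' ->
  (lab (set_val y) j).1 = (lab (set_val y') j).1 ->
  (lab (set_val y) (j + 1)).2 = (lab (set_val y') (j + 1)).2 ->
  Lambda U f y j = Lambda U f y' j <-> Lambda U f y (j + 1) = Lambda U f y' (j + 1).
Proof.
move=> Cy Cy' cy cy' k; rewrite !last_startS_start /Lambda -!/(start_label _ _).
have := last_startS y j; have := last_startS y' j.
case: (j + 1 =P next_start y j) => je; case: (j + 1 =P next_start y' j) => je' //; last first.
  by rewrite /start_label => -> ->.
move=> _ _ _; have T := start_label_step Cy je; have T' := start_label_step Cy' je'.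
pose D z j (Cz : Cset f z) cz := @start_label_sdom z j Cz cz.
have E z (Cz : Cset f z) (cz : constant_Pclass z) :
    block_type (B (lab (set_val z) j).1) (start_label z j, start_label z (j + 1)) ->
    p (lab (set_val z) j).1 (nclass_of (D z j Cz cz)) = nclass_of (D z (j + 1) Cz cz).
  by move=> Tz; apply: (pb_in (hB _)) => //; exact: cz.
have := E y Cy cy T; have := E y' Cy' cy' T'; rewrite -k => E' E1.
rewrite -(nclass_of_eq (D y j Cy cy) (D y' j Cy' cy')).
rewrite -(nclass_of_eq (D y (j + 1) Cy cy) (D y' (j + 1) Cy' cy')) -E1 -E'.
by split=> [->|/perm_inj].
Qed.

(** Equality at [n] is carried back to 0, undoing one after the other the permutations of the blocks
    in between. *)
Lemma Lambda_future y y' (n : int) : Cset f y -> Cset f y' ->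
  constant_Pclass y -> constant_Pclass y' -> agree_on [set n : int | 0 <= n] y y' -> 0 <= n ->
  Lambda U f y n = Lambda U f y' n -> Lambda U f y 0 = Lambda U f y' 0.
Proof.
move=> Cy Cy' cy cy' yy' n0; have H j : 0 <= j ->
    Lambda U f y j = Lambda U f y' j <-> Lambda U f y (j + 1) = Lambda U f y' (j + 1).
  move=> j0; apply: Lambda_step => //.
    by have [_ _ ->] := yy' j j0.
  by have [|_ _ ->] := yy' (j + 1) => //=; lia.
by apply: (int_step (Q := fun k => Lambda U f y k = Lambda U f y' k ->
  Lambda U f y 0 = Lambda U f y' 0) _ n0) => // j j0 _ IH E1; apply/IH/(H _ j0).
Qed.

Lemma Lambda_past y y' (n : int) : Cset f y -> Cset f y' ->
  constant_Pclass y -> constant_Pclass y' -> agree_on [set n : int | n < 0] y y' -> n < 0 ->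
  Lambda U f y n = Lambda U f y' n -> Lambda U f y 0 = Lambda U f y' 0.
Proof.
move=> Cy Cy' cy cy' yy' n0 En.
have L i : i < 0 -> lab (set_val y) i = lab (set_val y') i by move=> /yy'[].
(* For [j = -1] the flag at 0 lies outside the common past; it is nevertheless fixed by the start
   and the index of the block containing -1. *)
have S j : j < 0 -> (lab (set_val y) (j + 1)).2 = (lab (set_val y') (j + 1)).2.
  move=> j0; have E : last_start y j = last_start y' j.
    by apply: last_start_past => i ij; apply: L; lia.
  have [ij _ _] := last_startP y j.
  by rewrite !last_startS_start /next_start /block_length -E L //; lia.
apply: (int_step (Q := fun k => Lambda U f y k = Lambda U f y' k) _ (ltW n0)) => //.
move=> j nj j0 Ej; have -> // := (Lambda_step Cy Cy' cy cy' _ (S j j0)).1 Ej.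
by rewrite L.
Qed.

End Labels.

(** * Measurability in the space of concatenations *)

Section KMeasurable.
Variables (A : finType) (sigma : A) (l : nat) (B : 'I_l.+1 -> block sigma).
Implicit Types y : config sigma l.

Definition max_length : nat := \max_(k < l.+1) blen (B k).

Lemma covered_agree y y' j :
  (forall i, (absz (i - j) <= max_length)%N -> inp y i = inp y' i /\ lab y i = lab y' i) ->
  covered B y j -> covered B y' j.
Proof.
move=> H [i [ij ji b]]; have [b1 b2 b3] := b.
have lM : (block_length B y i <= max_length)%N by exact: (leq_bigmax (lab y i).1).
have H' r : (r <= block_length B y i)%N -> inp y (i + r%:Z) = inp y' (i + r%:Z) /\
    lab y (i + r%:Z) = lab y' (i + r%:Z).
  by move=> rl; apply: H; lia.
have E : lab y' i = lab y i by have := (H' 0%N isT).2; rewrite addr0.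
exists i; rewrite /block_at /block_length E; split=> //; split.
- by move=> r rl; rewrite -(H' r rl).1 b1.
- by move=> r rl; rewrite -(H' r (ltnW rl)).2 b2.
- by rewrite -(H' _ (leqnn _)).2.
Qed.

Lemma open_covered j : open [set y : config sigma l | covered B y j].
Proof.
apply: (finitely_determined_open (@coordinates_config A sigma l)).
pose w := [seq j + (k%:Z - max_length%:Z) | k <- iota 0 (2 * max_length).+1].
exists ([seq inl (inl (i, tt)) | i <- w] ++ [seq inr (i, tt) | i <- w]).
suff H y y' : {in [seq inl (inl (i, tt)) | i <- w] ++ [seq inr (i, tt) | i <- w],
    forall k, config_coord k y = config_coord k y'} -> covered B y j -> covered B y' j.
  by move=> y y' yy'; split; apply: H => // k ks; rewrite yy'.
move=> yy'; apply: covered_agree => i ij.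
have iw : i \in w.
  by apply/mapP; exists (absz (i - j + max_length%:Z)); rewrite ?mem_iota; lia.
split; apply: (pcan_inj pickleK).
  by apply: (yy' (inl (inl (i, tt)))); rewrite mem_cat (map_f (fun i => inl (inl (i, tt)))).
by apply: (yy' (inr (i, tt))); rewrite mem_cat (map_f (fun i => inr (i, tt))) ?orbT.
Qed.

Lemma config_coord_inj y y' : (forall j, config_coord j y = config_coord j y') -> y = y'.
Proof.
move=> H; case: y y' H => [[I x] b] [[I' x'] b'] H; congr (_, _, _); apply/funext => i.
- by apply: (pcan_inj pickleK); exact: (H (inl (inl (i, tt)))).
- by apply/funext => k; apply: (pcan_inj pickleK); exact: (H (inl (inr (i, (k, tt))))).
- by apply: (pcan_inj pickleK); exact: (H (inr (i, tt))).
Qed.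

Definition shift_coord (n : int) (j : (int * unit + int * (nat * unit)) + int * unit) :=
  match j with
  | inl (inl (i, t)) => inl (inl (n + i, t))
  | inl (inr (i, t)) => inl (inr (n + i, t))
  | inr (i, t) => inr (n + i, t)
  end.

Lemma config_coord_shift n j y :
  config_coord j (shift_config n y) = config_coord (shift_coord n j) y.
Proof. by case: j => [[[i []]|[i [k []]]]|[i []]]. Qed.

Lemma open_aperiodic n : open [set y : config sigma l | shift_config n y <> y].
Proof.
rewrite (_ : [set y | _] = \bigcup_j [set y | config_coord j (shift_config n y) != config_coord j y]).
  apply: bigcup_open => j _; apply: (finitely_determined_open (@coordinates_config A sigma l)).
  exists [:: j; shift_coord n j] => y y' yy' /=.
  by rewrite !config_coord_shift !yy' // !inE eqxx ?orbT.
apply/seteqP; split=> y /= H.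
  apply: contrapT => nH; apply: H; apply: config_coord_inj => j.
  by apply/eqP/negPn/negP => Hj; apply: nH; exists j.
by case: H => j _ /= /eqP H E; apply: H; rewrite E.
Qed.

(** Being covered at each position and being moved by each nonzero shift are countably many open
    conditions. *)
Lemma Gdelta_Kset : Gdelta (Kset B).
Proof.
pose V (i : int + int) : set (config sigma l) := match i with
  | inl j => [set y : config sigma l | covered B y j]
  | inr n => [set y : config sigma l | n != 0 -> shift_config n y <> y] end.
have oV i : open (V i).
  case: i => [j|n] /=; first exact: open_covered.
  have [->|n0] := eqVneq n 0.
    by rewrite (_ : [set _ | _] = setT); [exact: openT|apply/seteqP; split].
  rewrite (_ : [set _ | _] = [set y | shift_config n y <> y]); first exact: open_aperiodic.
  by apply/seteqP; split=> y /= H; [exact: H|move=> _].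
exists (fun k => if (unpickle k : option (int + int)) is Some i then V i else setT).
  by move=> k; case: (unpickle k) => [i|]; [exact: oV|exact: openT].
apply/seteqP; split=> y.
  move=> [Hc Hp] k _; case: (unpickle k) => [[j|n]|] //=; last exact: Hp.
  exact: concatenation_covered.
move=> H; split=> [|n n0].
  apply: covered_concatenation => j.
  by have := H (pickle (inl j : int + int)) I; rewrite pickleK.
by have := H (pickle (inr n : int + int)) I; rewrite pickleK; exact.
Qed.

Lemma measurable_Kset : measurable (Kset B : set (borel (config sigma l))).
Proof.
have [V oV ->] := Gdelta_Kset; apply: bigcapT_measurable => k; exact: sub_sigma_algebra.
Qed.

(** Carries events about [f] to the space of all configurations, where [nu] lives; it holds because
    [Kset B] is itself Borel there. *)
Lemma measurable_image_Kset (E : set (Kset B)) : <<s @open (Kset B) >> E ->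
  measurable (set_val @` E : set (borel (config sigma l))).
Proof.
move: E; apply: smallest_sub => [|_ [V oV <-]]; last first.
  rewrite (_ : _ @` _ = V `&` Kset B).
    by apply: measurableI; [exact: sub_sigma_algebra|exact: measurable_Kset].
  apply/seteqP; split=> y /=.
    by move=> [[z zK] /= Vz <-]; split=> //; exact: set_mem.
  by move=> [Vy Ky]; exists (exist _ y (mem_set Ky)).
split=> /=.
- by rewrite image_set0.
- move=> E mE; rewrite (_ : _ @` _ = Kset B `\` set_val @` E).
    exact: (@measurableD _ (borel (config sigma l)) _ _ measurable_Kset mE).
  apply/seteqP; split=> y /=.
    move=> [[z zK] /= [_ nE] <-]; split; first exact: set_mem.
    by move=> [w Ew /val_inj wz]; apply: nE; rewrite -wz.
  move=> [Ky nE]; exists (exist _ y (mem_set Ky)) => //; split=> // Ey.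
  by apply: nE; exists (exist _ y (mem_set Ky)).
- by move=> F mF; rewrite image_bigcup; exact: (@bigcupT_measurable _ (borel (config sigma l))).
Qed.

End KMeasurable.

Section GeneratedSigmaAlgebra.
Variables (T : Type) (G : set (set T)).

Lemma g_sigma_setC E : <<s G >> E -> <<s G >> (~` E).
Proof. by case: (smallest_sigma_algebra setT G) => _ H _ /H; rewrite setTD. Qed.

Lemma g_sigma_bigcup (I : countType) (F : I -> set T) :
  (forall i, <<s G >> (F i)) -> <<s G >> (\bigcup_i F i).
Proof.
move=> HF; rewrite (_ : \bigcup_i F i =
    \bigcup_k (if unpickle k is Some i then F i else set0)).
  apply: sigma_algebra_bigcup => k; case: (unpickle k) => [i|]; first exact: HF.
  by case: (smallest_sigma_algebra setT G).
apply/seteqP; split=> y [].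
  by move=> i _ Fy; exists (pickle i) => //; rewrite pickleK.
by move=> k _; case: (unpickle k) => // i Fy; exists i.
Qed.

Lemma g_sigma_bigcap (I : countType) (F : I -> set T) :
  (forall i, <<s G >> (F i)) -> <<s G >> (\bigcap_i F i).
Proof.
move=> HF; rewrite -[X in <<s _ >> X]setCK; apply: g_sigma_setC; rewrite setC_bigcap.
by apply: g_sigma_bigcup => i; exact: g_sigma_setC.
Qed.

Lemma g_sigma_setU E F : <<s G >> E -> <<s G >> F -> <<s G >> (E `|` F).
Proof.
move=> HE HF; rewrite (_ : E `|` F = \bigcup_(b : bool) if b then E else F).
  by apply: g_sigma_bigcup => -[].
apply/seteqP; split=> y; first by case=> ?; [exists true|exists false].
by case=> -[] _; [left|right].
Qed.

Lemma g_sigma_setI E F : <<s G >> E -> <<s G >> F -> <<s G >> (E `&` F).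
Proof.
move=> HE HF; rewrite -[E]setCK -[F]setCK -setCU.
by apply: g_sigma_setC; apply: g_sigma_setU; exact: g_sigma_setC.
Qed.

End GeneratedSigmaAlgebra.

Section LabelsMeasurable.
Variables (Pi : lcl) (sigma : Sin Pi) (l : nat) (B : 'I_l.+1 -> block sigma).
Variable f : Kset B -> bilateral (discrete_topology (Sout Pi)).
Hypothesis Hborel : borel_map f.

Lemma coordinates_Kset :
  coordinates (fun j (y : Kset B) => config_coord j (set_val y)).
Proof. exact/coordinates_sub/coordinates_config. Qed.

Lemma measurable_labels (n m : int) (Q : Sout Pi -> Sout Pi -> Prop) :
  <<s @open (Kset B) >> [set y | Q (f y n) (f y m)].
Proof.
apply: (Hborel (V := [set g | Q (g n) (g m)])).
apply: (@finitely_determined_open (bilateral (discrete_topology (Sout Pi))) (int * unit)%type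
    (fun j g => pickle (g j.1 : Sout Pi))).
  exact: (@coordinates_prod int _ _ _
    (@coordinates_discrete (discrete_topology (Sout Pi)) _ (pcan_inj (@pickleK (Sout Pi))))).
exists [:: (n, tt); (m, tt)] => g g' gg'.
have [/(pcan_inj pickleK) E1 /(pcan_inj pickleK) E2] :=
  (gg' (n, tt) (mem_head _ _), gg' (m, tt) (mem_last (n, tt) [:: (m, tt)])).
by rewrite /= in E1 E2; rewrite /= E1 E2.
Qed.

Lemma last_start_max (y : Kset B) i j : (lab (set_val y) i).2 -> i <= j ->
  i <= last_start y j.
Proof.
move=> si ij; rewrite leNgt; apply/negP => ji; have [_ jn b] := last_startP y j.
have := block_at_lab b (ltW ji) (le_lt_trans ij jn).
by move=> E; move: si; rewrite E /= => /eqP H; rewrite H ltxx in ji.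
Qed.

Lemma open_last_start i j : open [set y : Kset B | last_start y j = i].
Proof.
have [ij|ji] := leP i j; last first.
  rewrite (_ : [set y | _] = set0); first exact: open0.
  by apply/seteqP; split=> // y /= E; have [] := last_startP y j; rewrite E leNgt ji.
apply: (finitely_determined_open coordinates_Kset).
(* The labels on the interval from [i] to [j] decide whether [i] is the last start. *)
exists [seq inr (i + k%:Z, tt) | k <- iota 0 (absz (j - i)).+1].
set s := [seq _ | _ <- _].
suff H (y y' : Kset B) : {in s, forall k, config_coord k (set_val y) =
    config_coord k (set_val y')} -> last_start y j = i -> last_start y' j = i.
  by move=> y y' yy'; split; apply: H => // k ks; rewrite yy'.
move=> yy' yi.
have L k : i <= k -> k <= j -> lab (set_val y) k = lab (set_val y') k.
  move=> ik kj; apply: (pcan_inj pickleK); apply: (yy' (inr (k, tt))).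
  by apply/mapP; exists (absz (k - i)); rewrite ?mem_iota ?add0n; [lia|congr (inr (_, _)); lia].
have [_ _ b] := last_startP y j; have si := block_at_start b; rewrite yi in si.
have [y'j _ b'] := last_startP y' j; have si' := block_at_start b'.
have iy' : i <= last_start y' j by apply: last_start_max => //; rewrite -L.
apply/eqP; rewrite eq_le iy' andbT -yi; apply: last_start_max => //.
by rewrite L // yi.
Qed.

Lemma measurable_start_label (a : Sout Pi) :
  <<s @open (Kset B) >> [set y | start_label f y 0 = a].
Proof.
(* Splitting over the position of the last start turns the label into the value of [f y] at a fixed
   position. *)
rewrite (_ : [set y | _] = \bigcup_(n in [set: nat])
    ([set y | last_start y 0 = - n%:Z] `&` [set y | f y (- n%:Z) = a])).
  apply: g_sigma_bigcup => n; apply: g_sigma_setI.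
    by apply: sub_sigma_algebra; exact: open_last_start.
  exact: (measurable_labels (- n%:Z) 0 (fun b _ => b = a)).
apply/seteqP; split=> y /=.
  move=> E; exists (absz (last_start y 0)) => //=.
  have [l0 _ _] := last_startP y 0.
  by rewrite (_ : - _ = last_start y 0) //; lia.
by move=> [n _ /= [E <-]]; rewrite /start_label E.
Qed.

Lemma measurable_Cset : <<s @open (Kset B) >> (Cset f).
Proof.
(* Quantifying over the input pair [c] separates a condition on finitely many inputs from a
   condition on [f] at fixed positions; the implication becomes a union. *)
rewrite (_ : Cset f = \bigcap_(n in [set: int]) \bigcap_(c in [set: Sin Pi * Sin Pi])
    (~` [set y | (inp (set_val y) n, inp (set_val y) (n + 1)) = c] `|`
     [set y | allowed c (f y n, f y (n + 1))])).
  apply: g_sigma_bigcap => n; apply: g_sigma_bigcap => c.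
  apply: g_sigma_setU; last exact: (measurable_labels n (n + 1) (fun a b => allowed c (a, b))).
  apply: g_sigma_setC; apply: sub_sigma_algebra.
  apply: (finitely_determined_open coordinates_Kset).
  exists [:: inl (inl (n, tt)); inl (inl (n + 1, tt))] => y y' yy' /=.
  have /(pcan_inj pickleK) E1 := yy' (inl (inl (n, tt))) (mem_head _ _).
  have /(pcan_inj pickleK) E2 := yy' (inl (inl (n + 1, tt))) (mem_last (inl (inl (n, tt))) [:: inl (inl (n + 1, tt))]).
  by rewrite /inp; move: E1 E2 => /= -> ->.
apply/seteqP; split=> y /= H.
  move=> n _ c _ /=; have [E|nE] := pselect ((inp (set_val y) n, inp (set_val y) (n + 1)) = c).
    by right; rewrite /= -E; exact: H.
  by left.
move=> n; have [nE|//] := H n I (inp (set_val y) n, inp (set_val y) (n + 1)) I.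
by case: nE.
Qed.

End LabelsMeasurable.

(** * The measure case *)

Lemma negligible_bigcup_countType d (T : measurableType d) (R : realType)
    (mu : {measure set T -> \bar R}) (I : countType) (F : I -> set T) :
  (forall i, mu.-negligible (F i)) -> mu.-negligible (\bigcup_i F i).
Proof.
move=> HF; rewrite (_ : \bigcup_i F i =
    \bigcup_k (if unpickle k is Some i then F i else set0)).
  apply: negligible_bigcup => k; case: (unpickle k) => [i|]; first exact: HF.
  exact: negligible_set0.
apply/seteqP; split=> y [].
  by move=> i _ Fy; exists (pickle i) => //; rewrite pickleK.
by move=> k _; case: (unpickle k) => // i Fy; exists i.
Qed.

Section MeasureCase.
Variables (R : realType) (Pi : lcl) (sigma : Sin Pi) (U : subpartition (Sout Pi)).
Variables (l : nat) (B : 'I_l.+1 -> block sigma) (p : 'I_l.+1 -> {perm nclass U}).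
Hypothesis hB : forall i, permutation_block (B i) (p i).
Variable f : Kset B -> bilateral (discrete_topology (Sout Pi)).
Hypotheses (Hborel : borel_map f) (Hequiv : equivariant f).
Local Notation X := (borel (config sigma l)).
Variable P : probability X R.
Hypothesis Pshift : forall n (E : set X), measurable E -> P (shift_config n @^-1` E) = P E.
Hypothesis PC : P (set_val @` Cset f) = 1%E.

Definition label_set (a : Sout Pi) : set X := set_val @` [set y | start_label f y 0 = a].

Lemma measurable_label_set a : measurable (label_set a).
Proof. by apply: measurable_image_Kset; exact: measurable_start_label. Qed.

Lemma mem_label_set y n a :
  label_set a (shift_config n (set_val y)) <-> start_label f y n = a.
Proof.
rewrite -(start_label_shift n y Hequiv); split=> [[z za zy]|]; last by exists (shiftK n y).
have zE : shiftK n y = z by apply: Kset_inj; exact: esym zy.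
by rewrite zE; exact: za.
Qed.

(** Monotonicity of the P-class makes this event absorbing under the forward shift; letting [c]
    vary, these events detect every jump of the class. *)
Definition upper_set (c : Sout Pi) : set X := (set_val @` Cset f) `&`
  \bigcup_(a in [set a | prec U (Pclass U c) (Pclass U a)]) label_set a.

Lemma mem_upper_set y n c : Cset f y ->
  upper_set c (shift_config n (set_val y)) <->
  prec U (Pclass U c) (Pclass U (start_label f y n)).
Proof.
move=> Cy; split=> [[_ [a ca /mem_label_set ->//]]|H]; split.
  by exists (shiftK n y) => //; exact: Cset_shift.
by exists (start_label f y n) => //; exact/mem_label_set.
Qed.

Lemma measurable_upper_set c : measurable (upper_set c).
Proof.
apply: measurableI; first by apply: measurable_image_Kset; exact: measurable_Cset.
by apply: fin_bigcup_measurable => // a _; exact: measurable_label_set.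
Qed.

Lemma measurable_shift_preimage n (E : set X) : measurable E ->
  measurable (shift_config n @^-1` E : set X).
Proof. by move=> mE; rewrite -[Y in measurable Y]setTI; exact: measurable_shift_config. Qed.

(* upper_set c is contained in its preimage under the shift, and both have the same
   measure. *)
Lemma upper_set_jump_null c n :
  P (shift_config n @^-1` ((shift_config 1 @^-1` upper_set c) `\` upper_set c)) = 0%E.
Proof.
have mA := measurable_upper_set c; have mA1 := measurable_shift_preimage 1 mA.
rewrite Pshift; last exact: measurableD.
have fA : (P (shift_config 1 @^-1` upper_set c) < +oo)%E.
  by rewrite (le_lt_trans (probability_le1 P _)) // ltry.
rewrite measureD // (_ : _ `&` _ = upper_set c).
  by rewrite [X in (X - _)%E](Pshift 1 mA) subee // fin_num_measure.
apply/seteqP; split=> [y [//]|y Ay]; split=> //.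
have [[z Cz zy] _] := Ay; move: Ay; rewrite -zy -{1}(shift_config0 (set_val z)).
move=> /(mem_upper_set _ _ Cz) H; apply/(mem_upper_set 1 _ Cz).
apply: (prec_trans _ _ _ H); try exact: Pclass_partition.
exact: (prec_start_label_le hB).
Qed.

(** A jump between times [j] and [j + 1] means entering, at that moment, the upper set of the label
    just reached. This is a null event for each of the countably many pairs of a letter and a
    time. *)
Lemma jump_negligible : exists2 Z : set X, P.-negligible Z &
  forall y : Kset B, ~ Z (set_val y) -> Cset f y -> constant_Pclass U f y.
Proof.
exists (\bigcup_c \bigcup_n
  (shift_config n @^-1` ((shift_config 1 @^-1` upper_set c) `\` upper_set c))).
  apply: negligible_bigcup_countType => c; apply: negligible_bigcup_countType => n.
  apply/negligibleP; last exact: upper_set_jump_null.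
  apply: measurable_shift_preimage; apply: measurableD; last exact: measurable_upper_set.
  by apply: measurable_shift_preimage; exact: measurable_upper_set.
move=> y Zy Cy j; apply: prec_Pclass_anti; first exact: (prec_start_label hB j Cy).
apply: contrapT => nH; apply: Zy; exists (start_label f y (j + 1)) => //.
exists j => //; split; last by move/(mem_upper_set j _ Cy).
rewrite /preimage /= shift_configD; apply/(mem_upper_set _ _ Cy).
exact: (prec_refl (Pclass_partition _ _)).
Qed.

(* n M k is the k-th sampling time, chosen once the window radii M are known. *)
Lemma determined_negligible (J : set int) (n : (nat -> nat) -> nat -> int) :
  (forall M k i, (absz i <= M k)%N -> J (n M k + i)) ->
  exists2 Z : set X, P.-negligible Z & forall y y' : Kset B,
    ~ Z (set_val y) -> ~ Z (set_val y') -> agree_on J y y' ->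
    exists2 j, J j & start_label f y j = start_label f y' j.
Proof.
move=> HJ; have [N HN] := choice (fun a => tail_determined Pshift (measurable_label_set a)).
(* One radius for all letters, so that the sampling times do not depend on the letter. *)
pose M k := (\max_a N a k)%N.
have NM a k : (N a k <= M k)%N by exact: (leq_bigmax a).
have HJM a k i : (absz i <= N a k)%N -> J (n M k + i).
  by move=> iN; apply: HJ; exact: leq_trans (NM a k).
have /choice[Z HZ] : forall a, exists Z : set X, P.-negligible Z /\
    forall y y', ~ Z y -> ~ Z y' -> agree J y y' -> exists k0, forall k, (k0 <= k)%N ->
      label_set a (shift_config (n M k) y) <-> label_set a (shift_config (n M k) y').
  by move=> a; have [Z Z0 HZ] := HN a (n M) J (HJM a); exists Z.
exists (\bigcup_a Z a).
  by apply: negligible_bigcup_countType => a; case: (HZ a).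
move=> y y' Zy Zy' yy'.
have /choice[k0 Hk] : forall a, exists k0, forall k, (k0 <= k)%N ->
    start_label f y (n M k) = a <-> start_label f y' (n M k) = a.
  move=> a; have [||//|k0 Hk] := (HZ a).2 (set_val y) (set_val y').
  - by move=> Zay; apply: Zy; exists a.
  - by move=> Zay; apply: Zy'; exists a.
  - exists k0 => k /Hk; rewrite -!mem_label_set; exact.
(* Past all thresholds the equivalence holds for every letter at once, in particular for the letter
   of [y]. *)
pose k := (\max_a k0 a)%N; exists (n M k).
  by have := HJ M k 0 isT; rewrite addr0.
by apply/esym/(Hk (start_label f y (n M k)) k) => //; exact: (leq_bigmax (start_label f y (n M k))).
Qed.

Lemma measure_case : exists D : set (Kset B),
  [/\ D `<=` Sset U f, P.-negligible (~` (set_val @` D)),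
      Lambda0_determined U f D [set n : int | 0 <= n] &
      Lambda0_determined U f D [set n : int | n < 0]].
Proof.
have [Z0 NZ0 HZ0] := jump_negligible.
(* At time [M k] the window of radius [M k] stays among the nonnegative integers; for the past, time
   [- (M k).+1] keeps it among the negative ones. *)
have [Z1 NZ1 HZ1] := determined_negligible (J := [set n : int | 0 <= n])
  (n := fun M k => (M k)%:Z) (fun M k i iM => ltac:(rewrite /=; lia)).
have [Z2 NZ2 HZ2] := determined_negligible (J := [set n : int | n < 0])
  (n := fun M k => - (M k).+1%:Z) (fun M k i iM => ltac:(rewrite /=; lia)).
pose Z := ~` (set_val @` Cset f) `|` (Z0 `|` (Z1 `|` Z2)).
have NZ : P.-negligible Z.
  apply: negligibleU; last by apply: negligibleU => //; exact: negligibleU.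
  have mC : measurable (set_val @` Cset f : set X).
    by apply: measurable_image_Kset; exact: measurable_Cset.
  apply/negligibleP; first exact: measurableC.
  by apply: etrans (probability_setC P mC) _; rewrite PC subee.
have ZC (y : Kset B) : ~ Z (set_val y) -> Cset f y.
  move=> nZ; apply: contrapT => nC; apply: nZ; left => -[z Cz /Kset_inj zy].
  by apply: nC; rewrite -zy.
have Zc (y : Kset B) : ~ Z (set_val y) -> constant_Pclass U f y.
  by move=> nZ; apply: HZ0; [move=> H; apply: nZ; right; left|exact: ZC].
exists [set y | ~ Z (set_val y)]; split.
- by move=> y nZ; apply: constant_Pclass_Sset; [exact: ZC|exact: Zc].
- apply: negligibleS NZ => y nD; apply: contrapT => nZ; apply: nD.
  have [[z Cz zy]|nC] := pselect ((set_val @` Cset f) y); last by case: nZ; left.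
  by exists z; rewrite //= zy.
- move=> y y' nZ nZ' yy'.
  have [||//|j j0 Ej] := HZ1 y y'.
  - by move=> H; apply: nZ; right; right; left.
  - by move=> H; apply: nZ'; right; right; left.
  apply: (Lambda_future hB (ZC y nZ) (ZC y' nZ') (Zc y nZ) (Zc y' nZ') yy' j0).
  by rewrite /Lambda -!/(start_label _ _ _) Ej.
- move=> y y' nZ nZ' yy'.
  have [||//|j j0 Ej] := HZ2 y y'.
  - by move=> H; apply: nZ; right; right; right.
  - by move=> H; apply: nZ'; right; right; right.
  apply: (Lambda_past hB (ZC y nZ) (ZC y' nZ') (Zc y nZ) (Zc y' nZ') yy' j0).
  by rewrite /Lambda -!/(start_label _ _ _) Ej.
Qed.

End MeasureCase.

(** * The Baire case *)

Section Comeager.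
Variable T : topologicalType.
Implicit Types D E : set T.

Lemma comeagerS D E : D `<=` E -> comeager D -> comeager E.
Proof. by move=> DE [G HG GD]; exists G => // y /GD /DE. Qed.

Lemma comeager_open_dense D : open D -> dense D -> comeager D.
Proof. by move=> oD dD; exists D => //; exists (fun=> D) => //; rewrite bigcap_const //; exists 0%N. Qed.

Lemma comeagerT : comeager [set: T].
Proof. by apply: comeager_open_dense; [exact: openT|move=> W [y Wy] _; exists y]. Qed.

Lemma comeager_bigcap (K : countType) (D : K -> set T) :
  (forall i, comeager (D i)) -> comeager (\bigcap_i D i).
Proof.
move=> HD; have /choice[F HF] : forall i : K, exists F : nat -> set T,
    (forall k, open (F k) /\ dense (F k)) /\ \bigcap_k F k `<=` D i.
  by move=> i; have [_ [F oF ->] FD] := HD i; exists F.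
exists (\bigcap_n (if (unpickle n : option (K * nat)) is Some (i, k) then F i k else setT)).
  exists (fun n => if (unpickle n : option (K * nat)) is Some (i, k) then F i k else setT) => //.
  move=> n; case: (unpickle n) => [[i k]|]; first exact: (HF i).1.
  by split; [exact: openT|move=> W [y Wy] _; exists y].
move=> y Hy i _; apply: (HF i).2 => k _.
by have := Hy (pickle (i, k)) I; rewrite pickleK.
Qed.

Lemma comeagerI D E : comeager D -> comeager E -> comeager (D `&` E).
Proof.
move=> cD cE; apply: comeagerS (comeager_bigcap (D := fun b : bool => if b then D else E) _).
  by move=> y H; split; [exact: (H true I)|exact: (H false I)].
by case.
Qed.

Definition baire_property E : Prop :=
  exists2 O, open O & comeager [set y | E y <-> O y].

Lemma baire_property_setC E : baire_property E -> baire_property (~` E).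
Proof.
(* The witness is the exterior of [W]: the boundary of [W] is nowhere dense, and off it the exterior
   is the complement of [W]. *)
move=> [W oW EO]; exists (~` closure W); first exact/closed_openC/closed_closure.
have cO : comeager (W `|` ~` closure W).
  apply: comeager_open_dense.
    by apply: openU => //; exact/closed_openC/closed_closure.
  move=> V [y Vy] oV; have [cy|ncy] := pselect (closure W y); last by exists y; split=> //; right.
  have [z [Wz Vz]] := cy _ (open_nbhs_nbhs (conj oV Vy)).
  by exists z; split=> //; left.
apply: comeagerS (comeagerI EO cO) => y [] /= EOy [Wy|ncy]; split.
- by move/EOy: Wy.
- by move=> ncy Ey; apply: ncy; exact: subset_closure.
- by [].
- by move=> _ /EOy Wy; apply: ncy; exact: subset_closure.
Qed.

Lemma baire_property_bigcup (E : (set T)^nat) :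
  (forall i, baire_property (E i)) -> baire_property (\bigcup_i E i).
Proof.
move=> HE; have /choice[V HV] : forall i, exists V, open V /\ comeager [set y | E i y <-> V y].
  by move=> i; have [W] := HE i; exists W.
exists (\bigcup_i V i); first by apply: bigcup_open => i _; case: (HV i).
apply: comeagerS (comeager_bigcap (fun i => (HV i).2)) => y H.
by split=> -[i _ Ey]; exists i => //; apply/(H i I).
Qed.

Lemma borel_baire_property E : <<s @open T >> E -> baire_property E.
Proof.
move: E; apply: smallest_sub => [|O oO]; last first.
  by exists O => //; apply: comeagerS comeagerT.
split=> [|E|E]; last exact: baire_property_bigcup.
  by exists set0; [exact: open0|apply: comeagerS comeagerT].
by rewrite setTD; exact: baire_property_setC.
Qed.

End Comeager.

Lemma open_preimage_coordinates (S T : topologicalType) (J : countType)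
    (c : J -> T -> nat) (g : S -> T) : coordinates c ->
  (forall j v, open [set y | c j (g y) = v]) -> forall V, open V -> open (g @^-1` V).
Proof.
move=> cT og V oV; rewrite (open_cylinders cT oV) preimage_bigcup.
apply: bigcup_open => n _; rewrite preimage_bigcup; apply: bigcup_open => d _.
elim: d => [|[j v] d IHd].
  by rewrite (_ : _ @^-1` _ = setT); [exact: openT|apply/seteqP; split].
rewrite (_ : _ @^-1` _ = [set y | c j (g y) = v] `&` g @^-1` cylinder c d).
  by apply: openI IHd; exact: og.
rewrite (_ : (j, v) :: d = [:: (j, v)] ++ d) // cylinder_cat preimage_setI; congr (_ `&` _).
apply/seteqP; split=> y /=; first by move=> H; apply: (H (j, v)); rewrite mem_head.
by move=> H jv; rewrite inE => /eqP ->.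
Qed.

(** * Baire category in G-delta subspaces *)

Section GdeltaBaire.
Variables (T : topologicalType) (J : countType) (c : J -> T -> nat) (A : set T).
Hypothesis cT : coordinates c.
(* Completeness; taking pickle j as the modulus of the j-th coordinate loses nothing
   and spares a choice of moduli. *)
Hypothesis c_complete : forall y : nat -> T,
  (forall j k, (pickle j <= k)%N -> c j (y k) = c j (y (pickle j))) ->
  exists z, forall j, c j z = c j (y (pickle j)).
Hypothesis AG : Gdelta A.

(** Baire category argument: stage [k] freezes finitely many coordinates, enough to secure
    membership in [V k] and [G k] whatever the others become. The limit then lies in [A] and in
    every [G k]. *)
Lemma Gdelta_comeager_nonempty (y0 : A) (D : set A) : comeager D -> D !=set0.
Proof.
have [V oV AV] := AG; move=> [_ [G HG ->] GD].
have AV' y k : A y -> V k y by rewrite AV => /(_ k I).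
(* A state is a point of [A] together with the list of its frozen coordinates. *)
pose ok (k : nat) (st st' : A * seq J) := [/\ {subset st.2 <= st'.2},
  forall j, unpickle k = Some j -> j \in st'.2,
  {in st.2, forall j, c j (set_val st'.1) = c j (set_val st.1)},
  forall z, {in st'.2, forall j, c j z = c j (set_val st'.1)} -> V k z &
  forall z : A, {in st'.2, forall j, c j (set_val z) = c j (set_val st'.1)} -> G k z].
have step (kst : nat * (A * seq J)) : exists st', ok kst.1 kst.2 st'.
  case: kst => k [y s]; have cA := coordinates_sub A cT.
  have [ oG dG] := HG k.
  have [z [zy Gz]] : cylinder (fun j (y : A) => c j (set_val y))
      [seq (j, c j (set_val y)) | j <- s] `&` G k !=set0.
    apply: dG; last exact: cylinder_open.
    by exists y => _ /mapP[j _ ->].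
  have [s1 H1] := cA.2 _ _ (open_nbhs_nbhs (conj oG Gz)).
  have Vz : V k (set_val z) by apply: AV' (set_mem (valP z)).
  have [s2 H2] := cT.2 _ _ (open_nbhs_nbhs (conj (oV k) Vz)).
  exists (z, (if unpickle k is Some j then [:: j] else [::]) ++ s ++ s1 ++ s2); split=> /=.
  - by move=> j js; rewrite !mem_cat js !orbT.
  - by move=> j ->; rewrite mem_head.
  - by move=> j js; rewrite (zy _ (map_f (fun j => (j, c j (set_val y))) js)).
  - by move=> w Hw; apply: H2 => j js; apply: Hw; rewrite !mem_cat js !orbT.
  - by move=> w Hw; apply: H1 => j js; apply: Hw; rewrite !mem_cat js !orbT.
have /choice[next Hnext] := step.
pose st := fix st k := if k is k'.+1 then next (k', st k') else (y0, [::]).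
have Hst k : ok k (st k) (st k.+1) by exact: (Hnext (k, st k)).
have mono j k m : j \in (st k).2 -> (k <= m)%N ->
    j \in (st m).2 /\ c j (set_val (st m).1) = c j (set_val (st k).1).
  move=> jk; elim: m => [|m IHm]; first by rewrite leqn0 => /eqP <-.
  rewrite leq_eqVlt => /predU1P[<- //|/IHm[jm E]]; have [S _ H _ _] := Hst m.
  by split; [exact: S|rewrite H].
have jst j : j \in (st (pickle j).+1).2.
  by have [_ H _ _ _] := Hst (pickle j); apply: H; rewrite pickleK.
(* Coordinate [j] is frozen from stage [(pickle j).+1] on, so the sequence starts one stage late to
   have modulus [pickle j]. *)
have [z Hz] := c_complete (y := fun k => set_val (st k.+1).1)
  (fun j k jk => (mono j (pickle j).+1 k.+1 (jst j) jk).2).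
have zst k : {in (st k).2, forall j, c j z = c j (set_val (st k).1)}.
  move=> j jk; rewrite Hz -(mono _ _ _ (jst j) (leq_maxr k _)).2.
  by rewrite (mono _ _ _ jk (leq_maxl _ (pickle j).+1)).2.
have Az : A z.
  by rewrite AV => k _; have [_ _ _ H _] := Hst k; apply: H; exact: zst.
exists (exist _ z (mem_set Az)); apply: GD => k _.
by have [_ _ _ _ H] := Hst k; apply: H; exact: (zst k.+1).
Qed.

End GdeltaBaire.

(** * Gluing two configurations *)

Section Gluing.
Variables (A : finType) (sigma : A) (l : nat) (B : 'I_l.+1 -> block sigma).
Implicit Types y z w : config sigma l.

Lemma beta0 (b : block sigma) : beta b 0 = sigma.
Proof. by case: b => s h; rewrite /beta /= nth0; case/and3P: h => _ /eqP. Qed.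

Section Glue.
Variables (z w : config sigma l) (e n : int).
Variable x : int -> cantor_space.

(** [w] is translated so that its position [e - n] falls on the seam [e]. The Cantor component is
    left free, to be chosen so as to break periods. *)
Definition glue : config sigma l :=
  ((fun i => if i < e then inp z i else inp w (i - n)) : bilateral (pdiscrete sigma),
   (x : bilateral cantor_space),
   (fun i => if i < e then lab z i else lab w (i - n)) :
     bilateral (pdiscrete (ord0 : 'I_l.+1, true))).

Hypotheses (zcov : forall j, covered B z j) (wcov : forall j, covered B w j).
Hypotheses (ze : (lab z e).2) (we : (lab w (e - n)).2).

(** Both configurations have a block start at the seam, so no block crosses it. *)
Lemma glue_covered j : covered B glue j.
Proof.
have bz := covered_start (zcov e) ze; have bw := covered_start (wcov (e - n)) we.
(* A block of [z] may end at [e], where the glued input already follows [w]; both letters there are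
   [sigma]. *)
have inpe : inp z e = inp w (e - n).
  have [/(_ 0%N isT) + _ _] := bz; have [/(_ 0%N isT) + _ _] := bw.
  by rewrite !addr0 !beta0 => -> ->.
have inpl i : i <= e -> inp glue i = inp z i.
  by rewrite le_eqVlt /inp /= => /predU1P[->|->] //; rewrite ltxx -/(inp _ _) inpe.
have inpr i : e <= i -> inp glue i = inp w (i - n) by rewrite /inp /= leNgt => /negbTE ->.
have labl i : i < e -> lab glue i = lab z i by rewrite /lab /= => ->.
have labr i : e <= i -> lab glue i = lab w (i - n) by rewrite /lab /= leNgt => /negbTE ->.
have [je|ej] := ltP j e.
  have [i [ij ji [b1 b2 b3]]] := zcov j; have ie : i < e by exact: le_lt_trans ij je.
  have ee : i + (block_length B z i)%:Z <= e.
    rewrite leNgt; apply/negP => H.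
    move: ze; rewrite (block_at_lab (And3 b1 b2 b3) (ltW ie) H) /= => /eqP E.
    by rewrite E ltxx in ie.
  exists i; rewrite /block_at /block_length labl //; split=> //; split.
  - by move=> r rl; rewrite inpl; [exact: b1|rewrite /block_length in ee; lia].
  - by move=> r rl; rewrite labl; [exact: b2|rewrite /block_length in ee; lia].
  - rewrite -/(block_length B z i); move: ee; rewrite le_eqVlt => /predU1P[->|H].
      by rewrite labr.
    by rewrite labl.
have [i [ij ji [b1 b2 b3]]] := wcov (j - n).
have ei : e - n <= i.
  rewrite leNgt; apply/negP => H.
  have := block_at_lab (And3 b1 b2 b3) (ltW H) (le_lt_trans (lerB ej (lexx n)) ji).
  by move=> E; move: we; rewrite E /= => /eqP E'; rewrite E' ltxx in H.
have E : lab glue (i + n) = lab w i by rewrite labr ?addrK //; lia.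
have R (r : nat) : i + n + r%:Z - n = i + r%:Z by lia.
exists (i + n); rewrite /block_at /block_length E -/(block_length B w i).
split; [lia|lia|split].
- by move=> r rl; rewrite inpr ?R; [exact: b1|lia].
- by move=> r rl; rewrite labr ?R; [exact: b2|lia].
- by rewrite labr ?R //; lia.
Qed.

End Glue.

Lemma glue_Kset z w (N : nat) : (forall j, covered B z j) -> (forall j, covered B w j) ->
  exists (y : Kset B) (n : int), [/\ N%:Z <= n,
    agree [set i : int | (absz i <= N)%N] (set_val y) z &
    agree [set i : int | (absz i <= N)%N] (shift_config n (set_val y)) w].
Proof.
move=> zcov wcov.
(* [z] is cut at a start to the right of its window, [w] at a start not beyond the left end of its
   window; [n] superposes the two cuts. *)
have [e [eN ze]] : exists e, N%:Z < e /\ (lab z e).2.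
  have [i [ij ji [_ _ b]]] := zcov N%:Z.
  by exists (i + (block_length B z i)%:Z).
have [e' [e'N we]] : exists e', e' <= - N%:Z /\ (lab w e').2.
  by have [i [ij ji b]] := wcov (- N%:Z); exists i; split=> //; exact: block_at_start b.
pose n := e - e'; have nE : e' = e - n by rewrite /n; lia.
(* [s] exceeds every position of the two windows of radius [N], centred at 0 and at [n]. *)
pose s : int := N%:Z + N%:Z + n + 1.
(* Outside the windows x takes a different value at exactly one position s: no period. *)
pose x (i : int) : cantor_space :=
  if (absz i <= N)%N then rnd z i else if (absz (i - n) <= N)%N then rnd w (i - n)
  else fun _ => i == s.
pose y := glue z w e n x.
have ycov j : covered B y j by apply: glue_covered => //; rewrite -nE.
have xs i : s < `|i| -> x i = fun _ => false.
  move=> si; rewrite /x ifF; last by apply/negbTE; lia.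
  rewrite ifF; last by apply/negbTE; lia.
  by apply/funext => _; apply/negbTE; lia.
have xss : x s = fun _ => true.
  rewrite /x ifF; last by apply/negbTE; lia.
  rewrite ifF; last by apply/negbTE; lia.
  by rewrite eqxx.
have Ky : Kset B y.
  split; first exact: covered_concatenation.
  (* A period [m] would force the same value of [x] at [s] and at [s + |m|], where [x] is already
     constantly false. *)
  move=> m m0 ym; have per i : x (m + i) = x i.
    have : rnd (shift_config m y) i = rnd y i by rewrite ym.
    by [].
  have F : (fun _ : nat => true) <> (fun _ => false) by move=> /(congr1 (fun h => h 0%N)).
  case: (ltP 0 m) => m1.
    by apply: F; rewrite -xss -(per s) xs //; lia.
  apply: F; rewrite -xss (_ : s = m + (s - m)); last by lia.
  by rewrite per xs //; lia.
exists (exist _ y (mem_set Ky)), n; split; first by lia.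
- move=> i /= iN; have ie : i < e by lia.
  by split; rewrite /inp /lab /rnd /= ?ie // /x iN.
- move=> i /= iN; have ie : (n + i < e) = false by apply/negbTE; lia.
  have niE : n + i - n = i by lia.
  split; rewrite /inp /lab /rnd /= /Defs.shift /inp /lab /rnd /= ?ie ?niE //.
  by rewrite /x niE iN ifF //; apply/negbTE; lia.
Qed.

End Gluing.

(** * Generic configurations *)

Section BaireCase.
Variables (Pi : lcl) (sigma : Sin Pi) (U : subpartition (Sout Pi)).
Variables (l : nat) (B : 'I_l.+1 -> block sigma) (p : 'I_l.+1 -> {perm nclass U}).
Hypothesis hB : forall i, permutation_block (B i) (p i).
Variable f : Kset B -> bilateral (discrete_topology (Sout Pi)).
Hypotheses (Hborel : borel_map f) (Hequiv : equivariant f).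

Lemma config_coord_complete (y : nat -> config sigma l) :
  (forall (j : (int * unit + int * (nat * unit)) + int * unit) k,
    (pickle j <= k)%N -> @config_coord _ sigma l j (y k) = @config_coord _ sigma l j (y (pickle j))) ->
  exists z : config sigma l, forall j, @config_coord _ sigma l j z = @config_coord _ sigma l j (y (pickle j)).
Proof.
pose J : countType := ((int * unit + int * (nat * unit)) + int * unit)%type.
move=> _; exists ((fun i => (y (pickle (inl (inl (i, tt)) : J))).1.1 i),
  (fun i k => (y (pickle (inl (inr (i, (k, tt))) : J))).1.2 i k),
  (fun i => (y (pickle (inr (i, tt) : J))).2 i)).
by case=> [[[i []]|[i [k []]]]|[i []]].
Qed.

Lemma Kset_comeager_nonempty (y0 : Kset B) (D : set (Kset B)) : comeager D -> D !=set0.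
Proof.
exact: (Gdelta_comeager_nonempty (@coordinates_config _ sigma l) config_coord_complete
  (Gdelta_Kset B) y0).
Qed.

Lemma open_shiftK n (V : set (Kset B)) : open V -> open (shiftK n @^-1` V).
Proof.
apply: (open_preimage_coordinates (coordinates_Kset B)) => j v.
rewrite (_ : [set y | _] =
    [set y : Kset B | config_coord (shift_coord n j) (set_val y) = v]).
  exact: (coordinates_Kset B).1.
apply/seteqP; split=> y /= <-; last exact: config_coord_shift.
exact/esym/config_coord_shift.
Qed.

Lemma shiftKK n m (y : Kset B) : shiftK n (shiftK m y) = shiftK (m + n) y.
Proof.
apply: Kset_inj; change (shift_config n (shift_config m (set_val y)) =
  shift_config (m + n) (set_val y)).
exact: shift_configD.
Qed.

Lemma shiftK0 (y : Kset B) : shiftK 0 y = y.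
Proof.
apply: Kset_inj; change (shift_config 0 (set_val y) = set_val y); exact: shift_config0.
Qed.

Lemma comeager_shiftK n (D : set (Kset B)) : comeager D -> comeager (shiftK n @^-1` D).
Proof.
move=> [_ [G HG ->] GD]; exists (\bigcap_k (shiftK n @^-1` G k)); last first.
  by move=> y Gy; apply: GD => k _; exact: Gy.
exists (fun k => shiftK n @^-1` G k) => // k; split.
  by apply: open_shiftK; case: (HG k).
move=> V [y Vy] oV; have [_ dG] := HG k.
have [|z [Vz Gz]] := dG (shiftK (- n) @^-1` V) _ (open_shiftK (- n) oV).
  by exists (shiftK n y); rewrite /preimage /= shiftKK addrN shiftK0.
by exists (shiftK (- n) z); split=> //; rewrite /preimage /= shiftKK addNr shiftK0.
Qed.

(** [W] is a cylinder around [y] inside [V]: membership in it is read off a finite window, which may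
    fail for [V]. *)
Lemma Kset_window (V : set (Kset B)) (y : Kset B) : open V -> V y ->
  exists (N : nat) (W : set (Kset B)), [/\ open W, W y, W `<=` V & forall z z' : Kset B,
    agree [set i : int | (absz i <= N)%N] (set_val z) (set_val z') -> W z -> W z'].
Proof.
move=> oV Vy; have [s Hs] := (coordinates_Kset B).2 _ _ (open_nbhs_nbhs (conj oV Vy)).
pose c j (y : Kset B) := config_coord j (set_val y).
exists (\max_(j <- s) absz (config_pos j))%N, (cylinder c [seq (j, c j y) | j <- s]); split.
- exact: cylinder_open (coordinates_Kset B) _.
- by move=> _ /mapP[j _ ->].
- by move=> z Hz; apply: Hs => j js; exact: (Hz _ (map_f (fun j => (j, c j y)) js)).
- move=> z z' zz' Hz jv jd; rewrite -(Hz _ jd); have /mapP[j js ->] := jd.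
  apply/esym/(agree_config_coord zz').
  exact: (@leq_bigmax_seq _ _ xpredT (fun j => absz (config_pos j)) j).
Qed.

(** Topological transitivity with arbitrarily late visits, by gluing a point of [V] to a point of
    [W]. *)
Lemma open_visit (V W : set (Kset B)) (N : nat) : open V -> open W -> V !=set0 -> W !=set0 ->
  exists y n, [/\ N%:Z <= n, V y & W (shiftK n y)].
Proof.
move=> oV oW [v Vv] [w Ww].
have [N1 [V1 [_ V1v V1V H1]]] := Kset_window oV Vv.
have [N2 [W2 [_ W2w W2W H2]]] := Kset_window oW Ww.
have [y [n [nN yv yw]]] := glue_Kset (maxn N (maxn N1 N2))
  (Kset_covered v) (Kset_covered w).
exists y, n; split; first by lia.
- apply: V1V; apply: (H1 _ _ _ V1v) => i /= iN.
  by have [|-> -> ->] := yv i => //=; lia.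
- apply: W2W; apply: (H2 _ _ _ W2w) => i /= iN.
  have [|E1 E2 E3] := yw i; first by rewrite /=; lia.
  by split; [exact: esym E1|exact: esym E2|exact: esym E3].
Qed.

Lemma comeager_visit (W : set (Kset B)) (Q : set int) : open W ->
  (forall V, open V -> V !=set0 -> exists y n, [/\ Q n, V y & W (shiftK n y)]) ->
  comeager [set y | exists2 n, Q n & W (shiftK n y)].
Proof.
move=> oW HW; apply: comeager_open_dense.
  rewrite (_ : [set y | _] = \bigcup_(n in Q) (shiftK n @^-1` W)) //.
  by apply: bigcup_open => n _; exact: open_shiftK.
by move=> V V0 oV; have [y [n [Qn Vy Wn]]] := HW V oV V0; exists y; split=> //; exists n.
Qed.

Lemma comeager_visit_future (W : set (Kset B)) (N : nat) : open W -> W !=set0 ->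
  comeager [set y | exists2 n, N%:Z <= n & W (shiftK n y)].
Proof.
move=> oW W0; apply: (comeager_visit (Q := [set n | N%:Z <= n])) => // V oV V0.
exact: open_visit.
Qed.

Lemma comeager_visit_past (W : set (Kset B)) (N : nat) : open W -> W !=set0 ->
  comeager [set y | exists2 n, n <= - N%:Z & W (shiftK n y)].
Proof.
move=> oW W0; apply: (comeager_visit (Q := [set n | n <= - N%:Z])) => // V oV V0.
(* A past visit of a point of [V] to [W] is a future visit of a point of [W] to [V], seen from its
   end. *)
have [y [n [nN Wy Vn]]] := open_visit N oW oV W0 V0.
exists (shiftK n y), (- n); split=> //=; first by lia.
by rewrite shiftKK addrN shiftK0.
Qed.

(** Each event q(0) = a is Borel, hence open up to a meager set. By the category theorem some point
    satisfies all these equivalences at once; its own letter then has a nonempty open set. *)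
Lemma generic_label (y0 : Kset B) : comeager (Cset f) ->
  exists (a : Sout Pi) (W : set (Kset B)), [/\ open W, W !=set0 &
    comeager [set y | Cset f y /\ (W y -> start_label f y 0 = a)]].
Proof.
move=> cC; have /choice[V HV] : forall a, exists V, open V /\
    comeager [set y | start_label f y 0 = a <-> V y].
  move=> a; have [W oW HW] := borel_baire_property (measurable_start_label Hborel a).
  by exists W.
have cG : comeager (Cset f `&` \bigcap_a [set y | start_label f y 0 = a <-> V a y]).
  by apply: comeagerI => //; apply: comeager_bigcap => a; case: (HV a).
have [y [Cy Hy]] := Kset_comeager_nonempty y0 cG.
exists (start_label f y 0), (V (start_label f y 0)); split.
- by case: (HV (start_label f y 0)).
- by exists y; apply/(Hy _ I).
- by apply: comeagerS cG => z [Cz Hz]; split=> // Vz; apply/(Hz _ I).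
Qed.

Lemma baire_case : comeager (Cset f) -> exists D : set (Kset B),
  [/\ D `<=` Sset U f, comeager D,
      Lambda0_determined U f D [set n : int | 0 <= n] &
      Lambda0_determined U f D [set n : int | n < 0]].
Proof.
move=> cC; have [[y0 _]|no] := pselect ([set: Kset B] !=set0); last first.
  by exists (Cset f); split=> // y; case: no; exists y.
have [a [V [oV [w Vw] cV]]] := generic_label y0 cC.
(* Visits are counted in [W] rather than [V]: being read off a finite window, they are shared by
   configurations with a common future or past. *)
have [N [W [oW Ww WV HW]]] := Kset_window oV Vw; have W0 : W !=set0 by exists w.
pose G y := Cset f y /\ (V y -> start_label f y 0 = a).
(* Genericity at every time, and visits to [W] arbitrarily far in both directions. *)
pose D := (\bigcap_n (shiftK n @^-1` G)) `&`
  ((\bigcap_(k : nat) [set y | exists2 n, k%:Z <= n & W (shiftK n y)]) `&`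
   (\bigcap_(k : nat) [set y | exists2 n, n <= - k%:Z & W (shiftK n y)])).
have cD : comeager D.
  apply: comeagerI; first by apply: comeager_bigcap => n; exact: comeager_shiftK.
  apply: comeagerI; apply: comeager_bigcap => k.
    exact: comeager_visit_future.
  exact: comeager_visit_past.
have DC y : D y -> Cset f y by move=> [H _]; have [+ _] := H 0 I; rewrite shiftK0.
have DW y n : D y -> W (shiftK n y) -> start_label f y n = a.
  move=> [H _] Wn; rewrite -start_label_shift //.
  by have [_ Hn] := H n I; apply: Hn; exact: WV.
(* Between a visit at or before [j] and one at or after [j + 1], both with label [a], monotonicity
   leaves no room for a change of class. *)
have Dc y : D y -> constant_Pclass U f y.
  move=> Dy j; have [_ [Hf Hp]] := Dy; have Cy := DC y Dy.
  have [n1 n1j /(DW _ _ Dy) E1] := Hp (absz j) I.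
  have [n2 n2j /(DW _ _ Dy) E2] := Hf (absz j).+1 I.
  apply: prec_Pclass_anti; first exact: (prec_start_label hB j Cy).
  apply: (@prec_trans _ U _ _ _ (Pclass_partition U a) (Pclass_partition U _)
    (Pclass_partition U _)).
    by rewrite -{1}E2; apply: (prec_start_label_le hB Cy); lia.
  by rewrite -E1; apply: (prec_start_label_le hB Cy); lia.
have DS y y' n : agree_on [set i | absz (i - n) <= N]%N y y' -> D y -> D y' ->
    W (shiftK n y) -> start_label f y n = start_label f y' n.
  move=> yy' Dy Dy' Wn; rewrite (DW _ _ Dy Wn); apply/esym/(DW _ _ Dy')/(HW _ _ _ Wn) => i iN.
  have [|E1 E2 E3] := yy' (n + i); first by rewrite /= addrC addKr.
  by split; [exact: E1|exact: E2|exact: E3].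
exists D; split=> //.
- by move=> y Dy; apply: constant_Pclass_Sset; [exact: DC|exact: Dc].
(* A visit at some [n >= N] has its whole window in the common future; for the past, [N.+1] keeps
   the window strictly negative. *)
- move=> y y' Dy Dy' yy'; have [_ [Hf _]] := Dy; have [n nN Wn] := Hf N I.
  have n0 : 0 <= n by lia.
  apply: (Lambda_future hB (DC y Dy) (DC y' Dy') (Dc y Dy) (Dc y' Dy') yy' n0).
  rewrite /Lambda -!/(start_label _ _ _) (DS _ _ _ _ Dy Dy' Wn) // => i /= iN.
  by apply: yy' => /=; lia.
- move=> y y' Dy Dy' yy'; have [_ [_ Hp]] := Dy; have [n nN Wn] := Hp N.+1 I.
  have n0 : n < 0 by lia.
  apply: (Lambda_past hB (DC y Dy) (DC y' Dy') (Dc y Dy) (Dc y' Dy') yy' n0).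
  rewrite /Lambda -!/(start_label _ _ _) (DS _ _ _ _ Dy Dy' Wn) // => i /= iN.
  by apply: yy' => /=; lia.
Qed.

End BaireCase.

Theorem mainTheorem3
  (R : realType)
  (Pi : lcl) (sigma : Sin Pi) (U : subpartition (Sout Pi))
  (Hmix : mixing sigma U)
  (l : nat) (B : 'I_l.+1 -> block sigma)
  (p : 'I_l.+1 -> {perm nclass U})
  (hB : forall i, permutation_block (B i) (p i))
  (Hgen : <<[set p i | i : 'I_l.+1]%SET>>%g = Gamma sigma U)
  (u : probability (borel cantor_space) R) (Hu : uniform_cantor u)
  (lambda : probability (borel (bilateral cantor_space)) R)
  (Hlambda : is_product u lambda)
  (m : probability (borel (bilateral (pdiscrete (state0 B)))) R)
  (Hm : chain_law m)
  (f : Kset B -> bilateral (discrete_topology (Sout Pi)))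
  (Hborel : borel_map f) (Hequiv : equivariant f) :
  (nu lambda m (set_val @` Cset f) = 1%E ->
     exists D : set (Kset B),
       [/\ D `<=` Sset U f,
           (nu lambda m).-negligible (~` (set_val @` D)),
           Lambda0_determined U f D [set n : int | 0 <= n] &
           Lambda0_determined U f D [set n : int | n < 0]]) /\
  (comeager (Cset f) ->
     exists D : set (Kset B),
       [/\ D `<=` Sset U f,
           comeager D,
           Lambda0_determined U f D [set n : int | 0 <= n] &
           Lambda0_determined U f D [set n : int | n < 0]]).
Proof.
have [P [PE Pshift]] := nu_shift_invariant_probability Hlambda Hm.
split; last exact: (baire_case hB Hborel Hequiv).
by rewrite -PE => PC; exact: (measure_case hB Hborel Hequiv Pshift PC).
Qed.
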